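(* Let $R \subset \mathbb{R}$ be a GCD-domain, totally ordered by the usual order of $\mathbb{R}$. Then any $l$-algebra $(M_2(R), P)$ over $R$ (that is, the matrix algebra $M_2(R)$ equipped with a lattice order making it a lattice-ordered $R$-algebra, with positive cone $P$) is isomorphic, as an $l$-algebra over $R$, to $(M_2(R), P_A)$, where $P_A = A\, M_2(R^{+})$ for some $A \in M_2(R^{+})$ with $\det(A) \in R^{\times}$.
   Context: A GCD-domain is an integral domain (commutative, with $1$) in which any two non-zero elements have a greatest common divisor; here $R$ is a subring of $\mathbb{R}$. $R^{+} = \{r \in R : r \geq 0\}$, and $R^{\times}$ is the group of units of $R$. $M_2(R)$ is the ring of $2 \times 2$ matrices over $R$, $M_2(R^{+})$ is the set of matrices with all entries in $R^{+}$, and $A\, M_2(R^{+}) = \{AB : B \in M_2(R^{+})\}$. An $l$-algebra $(M_2(R), P)$ over $R$ is the $R$-algebra $M_2(R)$ with a subset $P$ (the positive cone) such that $P + P \subseteq P$, $P \cdot P \subseteq P$, $R^{+} P \subseteq P$, $P \cap (-P) = \{0\}$, and such that the partial order defined by $x \leq y \iff y - x \in P$ is a lattice order on $M_2(R)$. An isomorphism of $l$-algebras $(M_2(R), P) \cong (M_2(R), P')$ is an $R$-algebra isomorphism $\psi: M_2(R) \to M_2(R)$ with $\psi(P) = P'$. *)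

(* Defs.v *)
From HB Require Import structures.
From mathcomp Require Import all_boot all_order all_algebra.
From mathcomp Require Import classical_sets reals.

Set Implicit Arguments.
Unset Strict Implicit.
Unset Printing Implicit Defensive.

Import Order.TTheory GRing.Theory Num.Theory.
Local Open Scope classical_set_scope.
Local Open Scope ring_scope.

Definition rdvd (R : comNzRingType) (a b : R) : Prop := exists c, b = a * c.

Definition is_gcd (R : comNzRingType) (a b d : R) : Prop :=
  [/\ rdvd d a, rdvd d b & forall c, rdvd c a -> rdvd c b -> rdvd c d].

Definition GCD_domain (R : idomainType) : Prop :=
  forall a b : R, a != 0 -> b != 0 -> exists d, is_gcd a b d.

Section RealSubring.
(* A subring of the reals is a subtype R of K whose injection val is a ring
   morphism. R carries no order of its own: signs are read off in K. *)
Variables (K : realType) (S : {pred K}) (R : subIdomainType S).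
Implicit Types (P Q : set 'M[R]_2) (x y z : 'M[R]_2).

Definition nonneg : {pred R} := [pred r : R | 0 <= val r].

Definition nonnegM2 : set 'M[R]_2 := [set B | B \is a mxOver nonneg].

Definition cone_le P x y : Prop := P (y - x).

Definition is_join P x y z : Prop :=
  [/\ cone_le P x z, cone_le P y z &
      forall w, cone_le P x w -> cone_le P y w -> cone_le P z w].

Definition is_meet P x y z : Prop :=
  [/\ cone_le P z x, cone_le P z y &
      forall w, cone_le P w x -> cone_le P w y -> cone_le P w z].

(* Reflexivity, antisymmetry and transitivity of [cone_le P] follow from the
   cone axioms, so only the existence of joins and meets is required. *)
Record is_lalgebra P : Prop := IsLAlgebra {
  lalg_add : forall x y, P x -> P y -> P (x + y);
  lalg_mul : forall x y, P x -> P y -> P (x *m y);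
  lalg_scale : forall (r : R) x, r \in nonneg -> P x -> P (r *: x);
  lalg_pointed : P `&` [set - x | x in P] = [set 0];
  lalg_join : forall x y, exists z, is_join P x y z;
  lalg_meet : forall x y, exists z, is_meet P x y z
}.

Definition lalgebra_iso P Q : Prop :=
  exists psi : {lrmorphism 'M[R]_2 -> 'M[R]_2},
    bijective psi /\ psi @` P = Q.

Definition cone_of (A : 'M[R]_2) : set 'M[R]_2 :=
  [set A *m B | B in nonnegM2].

End RealSubring.

Arguments nonneg {K S R}.
Arguments nonnegM2 {K S R}.

(* Main.v *)
Require Import Defs.
From HB Require Import structures.
From mathcomp Require Import all_boot all_order all_algebra.
From mathcomp Require Import boolp classical_sets reals.
From mathcomp Require Import ring lra.

Set Implicit Arguments.
Unset Strict Implicit.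
Unset Printing Implicit Defensive.

Import Order.TTheory GRing.Theory Num.Theory.
Local Open Scope classical_set_scope.
Local Open Scope ring_scope.

(** Two facts about the cone [P] drive the proof: it is simplicial, and its
    extreme rays are spanned by matrices of rank one.

    Simplicial.  The matrix algebra is simple: multiplying by matrix units on
    both sides carries any nonzero entry of an element to every position.  If
    the elements of an order interval had unbounded entries, a single [y] would
    therefore dominate arbitrarily large multiples of all matrix units, hence of
    itself.  So order intervals are bounded ([order_interval_bounded]), which
    makes the lattice archimedean and embeds comparisons in real arithmetic.
    Pairwise disjoint positive elements are linearly independent, so there are
    at most four of them.  In a maximal such family everything below a member is
    proportional to it ([basic_proportional]), and each element of [P] is a sum
    of elements of [P] on the lines of the members ([cone_decomposition]).

    Rank one.  Extend scalars to the reals, where the cone [C] generated by the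
    family is closed.  By a Perron-Frobenius argument some [p] in [C] has real
    eigenvalues [mu < la] with [|mu| < la]; the normalized powers of [p] converge
    to a multiple of the singular matrix [p - mu], which therefore lies in [C]
    ([exists_pos_singular]).  A singular element of least support spans an
    extreme ray ([exists_extreme_singular]).  Writing it [u *m f], a second
    extreme ray in each of its one-sided ideals gives [u' *m f] and [u *m f'],
    and [u' *m f'] then spans the fourth ray.  With [X] the matrix of columns
    [u], [u'] and [Y] that of rows [f], [f'], the cone consists of the
    [X *m B *m Y] with [B] nonnegative ([simplicial_cone_structure]).

    Over a GCD-domain the columns and rows can be rescaled to primitive vectors,
    and every matrix over [R] on one of the four rays is an [R]-multiple of the
    product of the primitive column and row.  Hence [P] consists of the
    [U *m B *m V] with [U], [V] over [R] and [B] nonnegative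
    ([cone_factorization]).  Since [P] generates the algebra, [U] and [V] are
    invertible, and conjugation by [V] maps [P] onto the cone of
    [A = V *m U].  The entries of [A] are nonnegative because a ray
    [z = u *m f] satisfies [z *m z = (f u) z]. *)

(** * Matrices of size two and archimedean estimates *)

Lemma mul_delta_mx_entry (T : comNzRingType) m n p q (z : 'M[T]_(m, n))
    i j (k : 'I_p) (l : 'I_q) :
  delta_mx k i *m z *m delta_mx j l = z i j *: delta_mx k l.
Proof.
apply/matrixP => a b; rewrite !mxE (bigD1 j) //= big1 ?addr0; last first.
  by move=> c cj; rewrite [delta_mx j l _ _]mxE (negPf cj) mulr0.
rewrite !mxE (bigD1 i) //= big1 ?addr0; last first.
  by move=> c ci; rewrite !mxE (negPf ci) andbF mul0r.
by rewrite !mxE !eqxx !andbT /= mulrAC -natrM mulnb mulrC.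
Qed.

Lemma matrix_neq0_entry (T : nmodType) m n (x : 'M[T]_(m, n)) :
  x != 0 -> exists i j, x i j != 0.
Proof.
move=> x0; apply: contrapT => h; move/eqP: x0; apply.
apply/matrixP => i j; rewrite mxE; apply: contrapT => /eqP xij.
by apply: h; exists i, j.
Qed.

Lemma mulrn_bounded_le0 (K : realType) (a B : K) : (forall n, a *+ n <= B) -> a <= 0.
Proof.
move=> h; rewrite leNgt; apply/negP => a0.
have := h (Num.truncn (B / a)).+1; apply/negP; rewrite -ltNge.
by rewrite -[X in _ < X]mulr_natr mulrC -ltr_pdivrMr // truncnS_gt.
Qed.

(** With [h = 1 - q], Bernoulli gives [q ^+ n * (1 + n h) <= 1], so [- a n] stays
    bounded. *)
Lemma geometric_limit_ge0 (K : realType) (a c q : K) : 0 <= q -> q < 1 ->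
  (forall n, q ^+ n.+1 * c <= a) -> 0 <= a.
Proof.
move=> q0 q1 h; have [c0|c0] := lerP 0 c.
  by apply: le_trans (h 0%N); rewrite mulr_ge0 // exprn_ge0.
have e0 : 0 < 1 - q by rewrite subr_gt0.
have qn n : q ^+ n * (1 + (1 - q) *+ n) <= 1.
  elim: n => [|n IHn]; first by rewrite expr0 mulr0n addr0 mulr1.
  apply: le_trans IHn; rewrite exprSr -mulrA ler_wpM2l ?exprn_ge0 //.
  rewrite mulrSr; have : 0 <= (1 - q) *+ n by rewrite mulrn_wge0 // ltW.
  move: (_ *+ n) => s s0; nra.
rewrite -oppr_le0; apply: (@mulrn_bounded_le0 _ _ (- c / (1 - q))) => n.
rewrite ler_pdivlMr //.
have := qn n.+1; have := h n; have : 0 <= q ^+ n.+1 by exact: exprn_ge0.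
move: (q ^+ n.+1) => s s0 ha; rewrite mulrS => hs.
rewrite -[_ *+ n]mulr_natr; rewrite -[_ *+ n]mulr_natr in hs.
have : 0 <= n%:R :> K by [].
move: n%:R hs => N hs N0.
have : (- a) * ((1 - q) * N) <= (- c) * (s * ((1 - q) * N)).
  have : 0 <= ((1 - q) * N) by rewrite mulr_ge0 // ltW.
  move: ((1 - q) * N) => M M0; nra.
have : s * ((1 - q) * N) <= 1 by nra.
move: (s * _) => z z1; nra.
Qed.

Section TwoByTwo.
Variable T : comNzRingType.
Implicit Types (x y p : 'M[T]_2).

Lemma ord2P (i : 'I_2) : i = 0 \/ i = 1.
Proof. by case: i => [[|[|//]] hi]; [left|right]; apply: val_inj. Qed.

Lemma sum2E (V : nmodType) (F : 'I_2 -> V) : \sum_i F i = F 0 + F 1.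
Proof.
rewrite !big_ord_recl big_ord0 addr0; congr (F _ + F _); exact: val_inj.
Qed.

Lemma matrix2P x y : x 0 0 = y 0 0 -> x 0 1 = y 0 1 -> x 1 0 = y 1 0 ->
  x 1 1 = y 1 1 -> x = y.
Proof.
by move=> *; apply/matrixP => i j; case: (ord2P i) (ord2P j) => -> [] ->.
Qed.

Lemma det2E x : \det x = x 0 0 * x 1 1 - x 0 1 * x 1 0.
Proof.
rewrite (expand_det_row _ 0) sum2E /cofactor !det_mx11 !mxE /= expr0 mul1r.
rewrite expr1 mulN1r mulrN.
by congr (_ * x _ _ - _ * x _ _); apply: val_inj.
Qed.

Lemma mxtrace2E x : \tr x = x 0 0 + x 1 1.
Proof. exact: sum2E. Qed.

Lemma mulmx2E m n (x : 'M[T]_(m, 2)) (y : 'M[T]_(2, n)) i j :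
  (x *m y) i j = x i 0 * y 0 j + x i 1 * y 1 j.
Proof. by rewrite !mxE sum2E. Qed.

Lemma cayley_hamilton2 x : x *m x = \tr x *: x - (\det x)%:M.
Proof.
by apply: matrix2P; rewrite mulmx2E !mxE /= mxtrace2E det2E; ring.
Qed.

Lemma mxtrace_mul_self x : \tr (x *m x) = \tr x ^+ 2 - 2 * \det x.
Proof. by rewrite !mxtrace2E det2E !mulmx2E; ring. Qed.

(** A singular [x] is a product [u *m f] of a column and a row, and [f *m p *m u]
    is the scalar [\tr (x *m p)]. *)
Lemma singular_sandwich x p : \det x = 0 -> x *m p *m x = \tr (x *m p) *: x.
Proof.
rewrite det2E => /eqP; rewrite subr_eq0 => /eqP h.
by apply: matrix2P; rewrite !mulmx2E !mxE mxtrace2E !mulmx2E; ring: h.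
Qed.

Lemma mulmx_sum_col_row (x c y : 'M[T]_2) :
  x *m c *m y = \sum_a \sum_b c a b *: (col a x *m row b y).
Proof.
apply/matrixP => i j; rewrite !sum2E mulmx2E !mulmx2E !mxE !big_ord1 !mxE; ring.
Qed.

End TwoByTwo.

Section TwoByTwoField.
Variable F : fieldType.
Implicit Types (x y p : 'M[F]_2).

Lemma singular_fixed x : \det x = 0 -> x != 0 -> exists p, x *m p *m x = x.
Proof.
move=> dx /matrix_neq0_entry [i [j xij]]; exists ((x i j)^-1 *: delta_mx j i).
rewrite singular_sandwich // -scalemxAr mxtraceZ.
suff -> : \tr (x *m delta_mx j i) = x i j by rewrite mulVf // scale1r.
by case: (ord2P i) (ord2P j) => -> [] ->; rewrite mxtrace2E !mulmx2E !mxE /=; ring.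
Qed.

(** Simplicity of the matrix algebra, in the form that turns a statement about
    all [y *m p *m x] into one about [y]. *)
Lemma one_in_ideal x : x != 0 -> exists p q : 'I_2 -> 'M[F]_2,
  1%:M = \sum_k p k *m x *m q k.
Proof.
move=> /matrix_neq0_entry [i [j xij]].
exists (fun k => (x i j)^-1 *: delta_mx k i), (fun k => delta_mx j k).
rewrite -[LHS]scale1r -[X in X *: _](mulVf xij) -scalerA.
have -> : x i j *: (1%:M : 'M[F]_2) = \sum_k delta_mx k i *m x *m delta_mx j k.
  transitivity (\sum_(k < 2) x i j *: (delta_mx k k : 'M[F]_2)); last first.
    by apply: eq_bigr => k _; rewrite mul_delta_mx_entry.
  by rewrite -scaler_sumr; congr (_ *: _); apply: matrix2P;
     rewrite sum2E !mxE /= ?addr0 ?add0r.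
by rewrite scaler_sumr; apply: eq_bigr => k _; rewrite -!scalemxAl.
Qed.

Lemma rank1_factor x : \det x = 0 -> x != 0 ->
  exists (u : 'cV[F]_2) (f : 'rV[F]_2), x = u *m f.
Proof.
move=> dx x0.
have [i [j xij]] := matrix_neq0_entry x0.
exists (col j x), ((x i j)^-1 *: row i x).
apply/matrixP => k l; rewrite -scalemxAr !mxE big_ord1 !mxE.
move: dx xij; rewrite det2E => /eqP; rewrite subr_eq0 => /eqP dx xij.
apply: (mulfI xij); rewrite mulVKf // => {x0 xij}.
case: (ord2P i) (ord2P j) (ord2P k) (ord2P l) => -> [] -> [] -> [] ->;
  by [ring|ring: dx].
Qed.

Lemma not_all_left_multiples x : x != 0 -> exists p, forall c, p *m x != c *: x.
Proof.
move=> /matrix_neq0_entry [i [j xij]].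
have [k ki] : exists k : 'I_2, k != i by case: (ord2P i) => ->; [exists 1|exists 0].
exists (delta_mx k i) => c; apply/eqP => /matrixP e.
have := e k j; have := e i j; rewrite !mulmx2E !mxE eq_sym (negPf ki) /= !eqxx.
case: (ord2P i) ki xij => -> ki xij.
  rewrite /= !mul0r addr0 => /esym/eqP; rewrite mulf_eq0 (negPf xij) orbF.
  by move=> /eqP ->; rewrite !mul0r mul1r addr0 => /eqP; rewrite (negPf xij).
rewrite /= !mul0r addr0 => /esym/eqP; rewrite mulf_eq0 (negPf xij) orbF.
by move=> /eqP ->; rewrite !mul0r mul1r add0r => /eqP; rewrite (negPf xij).
Qed.

Lemma det0_col_multiple x : \det x = 0 -> col 0 x != 0 ->
  exists c, col 1 x = c *: col 0 x.
Proof.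
rewrite det2E => /eqP; rewrite subr_eq0 => /eqP dx /matrix_neq0_entry [i [j]].
rewrite !mxE => xi; exists (x i 1 / x i 0); apply/matrixP => k l; rewrite !mxE.
apply: (mulfI xi); rewrite [RHS]mulrA [x i 0 * (_ / _)]mulrC divfK //.
by case: (ord2P i) (ord2P k) => -> [] -> {xi}; ring: dx.
Qed.

Lemma common_direction (u w : 'cV[F]_2) (f g : 'rV[F]_2) : u != 0 ->
  u *m g = w *m f -> exists c, u *m g = c *: (u *m f).
Proof.
move=> /matrix_neq0_entry [i [j]]; rewrite ord1 => ui e.
exists (w i 0 / u i 0); apply/matrixP => k l.
have := congr1 (fun m : 'M_2 => m i l) e; rewrite !mxE !big_ord1 => e'.
apply: (mulfI ui); rewrite [RHS]mulrA [u i 0 * (_ / _)]mulrC divfK //.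
ring: e'.
Qed.

Lemma mulmx_rank1 (u w : 'cV[F]_2) (f g : 'rV[F]_2) p :
  u *m f *m p *m (w *m g) = (f *m p *m w) 0 0 *: (u *m g).
Proof.
rewrite !mulmxA -[u *m f *m p]mulmxA -[u *m _ *m w]mulmxA [f *m p *m w]mx11_scalar.
by rewrite mul_mx_scalar -scalemxAl [in RHS]mxE eqxx mulr1n.
Qed.

End TwoByTwoField.

(** * Disjointness in a lattice-ordered matrix algebra *)

Section OrderedCone.
Variables (K : realType) (S : {pred K}) (R : subIdomainType S).
Variables (P : set 'M[R]_2) (hP : is_lalgebra P).
Implicit Types (r s : R) (x y z u v w : 'M[R]_2).

Notation "x <=P y" := (cone_le P x y) (at level 70).

Lemma val_natr n : val (n%:R : R) = n%:R.
Proof. by rewrite rmorph_nat. Qed.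

Lemma val_eq0R r : (val r == 0) = (r == 0).
Proof. by rewrite -(inj_eq val_inj) rmorph0. Qed.

Lemma val_mulR r s : val (r * s) = val r * val s.
Proof. exact: rmorphM. Qed.

Lemma nonnegE r : (r \in nonneg) = (0 <= val r).
Proof. by []. Qed.

Lemma natr_nonneg n : (n%:R : R) \in nonneg.
Proof. by rewrite nonnegE val_natr. Qed.

Lemma cone0 : P 0.
Proof. by have [] : (P `&` [set - x | x in P]) 0 by rewrite (lalg_pointed hP). Qed.

Lemma cone_eq0 x : P x -> P (- x) -> x = 0.
Proof.
move=> Px PNx; have : (P `&` [set - x | x in P]) x.
  by split=> //; exists (- x) => //; rewrite opprK.
by rewrite (lalg_pointed hP).
Qed.

Lemma cone_sum (I : Type) (l : seq I) (p : pred I) (F : I -> 'M[R]_2) :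
  (forall i, p i -> P (F i)) -> P (\sum_(i <- l | p i) F i).
Proof.
move=> PF; elim/big_ind: _ => //; first exact: cone0.
exact: lalg_add.
Qed.

Lemma cone_le0 x : (0 <=P x) = P x.
Proof. by rewrite /cone_le subr0. Qed.

Lemma cone_lexx x : x <=P x.
Proof. by rewrite /cone_le subrr; exact: cone0. Qed.

Lemma cone_le_trans y x z : x <=P y -> y <=P z -> x <=P z.
Proof.
by move=> lxy lyz; have := lalg_add hP lyz lxy; rewrite /cone_le addrA subrK.
Qed.

Lemma cone_leD x y z w : x <=P y -> z <=P w -> x + z <=P y + w.
Proof.
move=> lxy lzw; have := lalg_add hP lxy lzw.
by rewrite /cone_le opprD addrACA.
Qed.

Lemma cone_leZ r x y : r \in nonneg -> x <=P y -> r *: x <=P r *: y.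
Proof. by move=> r0 lxy; rewrite /cone_le -scalerBr; exact: lalg_scale. Qed.

Lemma coneMn x n : P x -> P (x *+ n).
Proof.
by move=> Px; rewrite -scaler_nat; apply: lalg_scale => //; exact: natr_nonneg.
Qed.

(** The first summand is the meet of [x] and [y]. *)
Lemma riesz_decomposition x y z : P x -> P y -> P z -> x <=P y + z ->
  exists x1 x2, [/\ P x1, P x2, x = x1 + x2, x1 <=P y & x2 <=P z].
Proof.
move=> Px Py Pz lx; have [m [mx my mP]] := lalg_meet hP x y.
exists m, (x - m); split=> //.
- by rewrite -cone_le0; apply: mP; rewrite cone_le0.
- by rewrite addrC subrK.
- suff : x - z <=P m by rewrite /cone_le !opprB addrCA [m + _]addrC addrA.
  apply: mP; rewrite /cone_le; first by rewrite opprB addrC subrK.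
  by rewrite opprB addrA.
Qed.

(** For positive [u] and [v] this is [u /\ v = 0], phrased without naming meets. *)
Definition disjoint_elts u v :=
  forall w, P w -> w <=P u -> w <=P v -> w = 0.

Lemma disjoint_elts_sym u v : disjoint_elts u v -> disjoint_elts v u.
Proof. by move=> duv w Pw wv wu; exact: duv. Qed.

Lemma disjoint_elts_le u u' v :
  u <=P u' -> disjoint_elts u' v -> disjoint_elts u v.
Proof.
by move=> lu d w Pw wu wv; apply: d => //; exact: cone_le_trans lu.
Qed.

Lemma disjoint_eltsD u u' v : P u -> P u' ->
  disjoint_elts u v -> disjoint_elts u' v -> disjoint_elts (u + u') v.
Proof.
move=> Pu Pu' d d' w Pw wu wv.
have [w1 [w2 [Pw1 Pw2 ew l1 l2]]] := riesz_decomposition Pw Pu Pu' wu.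
have w10 : w1 = 0.
  apply: d Pw1 l1 _.
  by apply: cone_le_trans wv; rewrite /cone_le ew addrC addKr.
have w20 : w2 = 0.
  apply: d' Pw2 l2 _.
  by apply: cone_le_trans wv; rewrite /cone_le ew addrK.
by rewrite ew w10 w20 addr0.
Qed.

Lemma disjoint_elts0 v : disjoint_elts 0 v.
Proof.
by move=> w Pw w0 _; apply: cone_eq0 => //; move: w0; rewrite /cone_le sub0r.
Qed.

Lemma disjoint_elts_sum (I : Type) (l : seq I) (p : pred I)
    (F : I -> 'M[R]_2) v :
  (forall i, p i -> P (F i)) -> (forall i, p i -> disjoint_elts (F i) v) ->
  disjoint_elts (\sum_(i <- l | p i) F i) v.
Proof.
move=> PF dF; suff [] : P (\sum_(i <- l | p i) F i) /\
  disjoint_elts (\sum_(i <- l | p i) F i) v by [].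
elim/big_ind: _ => [|x y [Px dx] [Py dy]|i pi].
- by split; [exact: cone0|exact: disjoint_elts0].
- by split; [exact: (lalg_add hP)|exact: disjoint_eltsD].
- by split; [exact: PF|exact: dF].
Qed.

(** [R] is archimedean, so [r *: u] lies below a finite sum of copies of [u]. *)
Lemma disjoint_eltsZ r u v : P u -> r \in nonneg ->
  disjoint_elts u v -> disjoint_elts (r *: u) v.
Proof.
move=> Pu r0 d; pose n := (Num.truncn (val r)).+1.
apply: (@disjoint_elts_le _ (\sum_(i < n) u)); last first.
  by apply: disjoint_elts_sum.
rewrite sumr_const card_ord -scaler_nat /cone_le -scalerBl.
apply: lalg_scale => //; rewrite nonnegE rmorphB /= val_natr subr_ge0.
by apply/ltW; rewrite /n truncnS_gt.
Qed.

Lemma disjoint_diff x y : exists m, [/\ m <=P x, m <=P y,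
  P x -> P y -> P m & disjoint_elts (x - m) (y - m)].
Proof.
have [m [mx my mP]] := lalg_meet hP x y; exists m; split=> //.
  by rewrite -!cone_le0 => lx ly; exact: mP.
move=> w Pw wx wy; apply: cone_eq0 => //.
suff : m + w <=P m by rewrite /cone_le opprD addNKr.
by apply: mP; rewrite /cone_le opprD addrA.
Qed.

Lemma pos_neg_parts x : exists u v, [/\ P u, P v, x = u - v & disjoint_elts u v].
Proof.
have [m [mx m0 _ d]] := disjoint_diff x 0.
exists (x - m), (0 - m); split=> //.
by rewrite sub0r opprK subrK.
Qed.

(** A multiple by a positive scalar cannot cancel a negative part: the negative
    part would lie below a multiple of the positive part disjoint from it. *)
Lemma coneZ_inv s x : 0 < val s -> P (s *: x) -> P x.
Proof.
move=> s0 Psx; have [u [v [Pu Pv xE d]]] := pos_neg_parts x; move: Psx; rewrite xE => Psx.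
have s0' : s \in nonneg by rewrite nonnegE ltW.
suff -> : v = 0 by rewrite subr0.
have sv0 : s *: v = 0.
  apply: (disjoint_eltsZ Pv s0' (disjoint_elts_sym (disjoint_eltsZ Pu s0' d))).
  - exact: lalg_scale.
  - exact: cone_lexx.
  - by rewrite /cone_le -scalerBr.
have sn0 : s != 0 by apply: contraTneq s0 => ->; rewrite rmorph0 ltxx.
apply/matrixP => i j; rewrite mxE.
by move/matrixP/(_ i j)/eqP: sv0; rewrite !mxE mulf_eq0 (negPf sn0) => /eqP.
Qed.

(** ** Boundedness of order intervals *)

Definition abs_le z y := z <=P y /\ - y <=P z.

Lemma abs_leE z y : abs_le z y <-> P (y - z) /\ P (y + z).
Proof. by rewrite /abs_le /cone_le opprK [z + y]addrC. Qed.

Lemma abs_le_ge0 z y : abs_le z y -> P y.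
Proof.
move=> /abs_leE [h1 h2].
apply: (@coneZ_inv 2); first by rewrite val_natr ltr0n.
have := lalg_add hP h1 h2; rewrite addrACA addNr addr0.
by rewrite scaler_nat mulr2n.
Qed.

Lemma abs_leN z y : abs_le z y -> abs_le (- z) y.
Proof. by move=> /abs_leE [h1 h2]; apply/abs_leE; rewrite opprK. Qed.

Lemma abs_leD z y z' y' : abs_le z y -> abs_le z' y' -> abs_le (z + z') (y + y').
Proof.
move=> [h1 h2] [h3 h4]; split; first exact: cone_leD.
by rewrite opprD; exact: cone_leD.
Qed.

Lemma abs_le_sum (I : Type) (l : seq I) (p : pred I) (F G : I -> 'M[R]_2) :
  (forall i, abs_le (F i) (G i)) ->
  abs_le (\sum_(i <- l | p i) F i) (\sum_(i <- l | p i) G i).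
Proof.
move=> h; elim/big_ind2: _ => //; last by move=> *; exact: abs_leD.
by split; rewrite ?oppr0; exact: cone_lexx.
Qed.

Lemma abs_le_trans z y y' : abs_le z y -> y <=P y' -> abs_le z y'.
Proof.
move=> [h1 h2] l; split; first exact: cone_le_trans l.
by apply: cone_le_trans h2; rewrite /cone_le opprK addrC.
Qed.

Lemma abs_leZ_ge0 r z y : r \in nonneg -> abs_le z y -> abs_le (r *: z) (r *: y).
Proof.
by move=> r0 [h1 h2]; split; rewrite -?scalerN; exact: cone_leZ.
Qed.

Definition absR r : R := if 0 <= val r then r else - r.

Lemma val_absR r : val (absR r) = `|val r|.
Proof.
rewrite /absR; case: ifPn => [r0|]; first by rewrite ger0_norm.
by rewrite -ltNge => r0; rewrite ltr0_norm // rmorphN.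
Qed.

Lemma absR_nonneg r : absR r \in nonneg.
Proof. by rewrite nonnegE val_absR. Qed.

Lemma abs_leZ r z y : abs_le z y -> abs_le (r *: z) (absR r *: y).
Proof.
move=> h; have := abs_leZ_ge0 (absR_nonneg r) h.
rewrite {1}/absR; case: ifP => // _ /abs_leN; by rewrite scaleNr opprK.
Qed.

Lemma abs_leMl a z y : P a -> abs_le z y -> abs_le (a *m z) (a *m y).
Proof.
move=> Pa /abs_leE [h1 h2]; apply/abs_leE.
by rewrite -mulmxBr -mulmxDr; split; exact: lalg_mul.
Qed.

Lemma abs_leMr a z y : P a -> abs_le z y -> abs_le (z *m a) (y *m a).
Proof.
move=> Pa /abs_leE [h1 h2]; apply/abs_leE.
by rewrite -mulmxBl -mulmxDl; split; exact: lalg_mul.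
Qed.

Lemma abs_le_mulmx a c y : exists y', forall z, abs_le z y -> abs_le (a *m z *m c) y'.
Proof.
have [a1 [a2 [Pa1 Pa2 -> _]]] := pos_neg_parts a.
have [c1 [c2 [Pc1 Pc2 -> _]]] := pos_neg_parts c.
exists ((a1 *m y + a2 *m y) *m c1 + (a1 *m y + a2 *m y) *m c2) => z h.
have h' : abs_le ((a1 - a2) *m z) (a1 *m y + a2 *m y).
  by rewrite mulmxBl; apply: abs_leD; [|apply: abs_leN]; exact: abs_leMl.
by rewrite mulmxBr; apply: abs_leD; [|apply: abs_leN]; exact: abs_leMr.
Qed.

(** Multiplying by matrix units spreads one entry [r] of an element of the
    interval over all positions, so some [y] dominates every [r *: delta_mx k l]
    at once.  Expanding [y] itself in matrix units then gives
    [r *: y <= c *: y] with [c] independent of [r], whence [r <= c].  This is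
    where the simplicity of the matrix algebra excludes infinitesimals. *)
Lemma order_interval_bounded y : exists B : K,
  forall z, abs_le z y -> forall i j, `|val (z i j)| <= B.
Proof.
suff H i j : exists B : K, forall z, abs_le z y -> `|val (z i j)| <= B.
  have /choice [B hB] : forall ij : 'I_2 * 'I_2, exists B : K,
    forall z, abs_le z y -> `|val (z ij.1 ij.2)| <= B by move=> [i j]; exact: H.
  exists (\sum_ij `|B ij|) => z hz i j.
  apply: le_trans (hB (i, j) z hz) _; rewrite (bigD1 (i, j)) //=.
  by apply: ler_wpDr; [exact: sumr_ge0|exact: ler_norm].
have /choice [Y hY] : forall kl : 'I_2 * 'I_2, exists y', forall z,
    abs_le z y -> abs_le (z i j *: delta_mx kl.1 kl.2) y'.
  move=> [k l]; have [y' hy'] := abs_le_mulmx (delta_mx k i) (delta_mx j l) y.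
  by exists y' => z /hy'; rewrite mul_delta_mx_entry.
(* [T] dominates all [z i j *: delta_mx k l]; [c] is the sum of the absolute values
   of its entries. *)
pose T := \sum_kl Y kl; pose c : R := \sum_k \sum_l absR (T k l).
have c0 : 0 <= val c.
  rewrite /c rmorph_sum; apply: sumr_ge0 => k _; rewrite rmorph_sum.
  by apply: sumr_ge0 => l _; exact: absR_nonneg.
suff main z : abs_le z y -> val (z i j) <= val c.
  exists (val c) => z hz; rewrite ler_norml main // andbT lerNl.
  by have := main _ (abs_leN hz); rewrite mxE rmorphN.
move=> hz; set r := z i j.
have hT k l : abs_le (r *: delta_mx k l) T.
  apply: abs_le_trans (hY (k, l) z hz) _; rewrite /T (bigD1 (k, l)) //=.
  rewrite /cone_le addrAC subrr add0r; apply: cone_sum => kl _.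
  exact: abs_le_ge0 (hY kl z hz).
have hrT : abs_le (r *: T) (c *: T).
  have -> : r *: T = \sum_k \sum_l T k l *: (r *: delta_mx k l).
    rewrite {1}[T]matrix_sum_delta scaler_sumr; apply: eq_bigr => k _.
    rewrite scaler_sumr; apply: eq_bigr => l _.
    by rewrite !scalerA mulrC.
  rewrite /c scaler_suml; apply: abs_le_sum => k.
  by rewrite scaler_suml; apply: abs_le_sum => l; exact: abs_leZ.
rewrite leNgt; apply/negP => cr.
have rc0 : 0 < val (r - c) by rewrite rmorphB /= subr_gt0.
have PT : P T by exact: abs_le_ge0 (hT ord0 ord0).
have T0 : (r - c) *: T = 0.
  apply: cone_eq0; first by apply: lalg_scale => //; rewrite nonnegE ltW.
  by case: hrT => + _; rewrite /cone_le -scalerBl -scaleNr opprB.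
have rcn0 : r - c != 0 by apply: contraTneq rc0 => ->; rewrite rmorph0 ltxx.
have {}T0 k l : T k l = 0.
  by move/matrixP/(_ k l)/eqP: T0; rewrite !mxE mulf_eq0 (negPf rcn0) => /eqP.
have {}T0 : T = 0 by apply/matrixP => k l; rewrite mxE.
have [h1 h2] := hT ord0 ord0; move: h1 h2; rewrite T0 /cone_le oppr0 subr0 sub0r.
move=> h1 h2; have /matrixP/(_ ord0 ord0) := cone_eq0 h2 h1.
rewrite !mxE !eqxx mulr1 => r0.
by move: cr; rewrite r0 rmorph0 ltNge c0.
Qed.

(** ** Decomposition of the cone along lines *)

(** Cross-multiplied, so that no division in [R] is involved. *)
Definition proportional (x y : 'M[R]_2) :=
  forall i j k l, x i j * y k l = x k l * y i j.

Lemma proportional0 y : proportional 0 y.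
Proof. by move=> i j k l; rewrite !mxE !mul0r. Qed.

Lemma proportionalD x x' y :
  proportional x y -> proportional x' y -> proportional (x + x') y.
Proof. by move=> h h' i j k l; rewrite !mxE !mulrDl h h'. Qed.

Lemma proportionalB x x' y :
  proportional x y -> proportional x' y -> proportional (x - x') y.
Proof. by move=> h h' i j k l; rewrite !mxE !mulrBl h h'. Qed.

Lemma proportionalMn y n : proportional (y *+ n) y.
Proof. by move=> i j k l; rewrite !mulmxnE !mulrnAl mulrC. Qed.

Lemma proportional_scale x y k l : proportional x y ->
  y k l *: x = x k l *: y.
Proof. by move=> h; apply/matrixP => i j; rewrite !mxE mulrC h. Qed.

Lemma proportional_cone x y k l : P y -> proportional x y ->
  y k l != 0 -> 0 <= val (x k l * y k l) -> P x.
Proof.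
move=> Py h y0 xy0; apply: (@coneZ_inv (y k l * y k l)).
  have yv : val (y k l) != 0 by rewrite val_eq0R.
  by rewrite rmorphM -expr2 exprn_even_gt0.
rewrite -scalerA (proportional_scale k l h) scalerA mulrC.
exact: lalg_scale.
Qed.

(** Equivalently, the order interval from [0] to [b] is totally ordered. *)
Definition basic_elt b := forall u v, P u -> P v -> u <=P b -> v <=P b ->
  disjoint_elts u v -> u = 0 \/ v = 0.

Lemma not_disjoint_multiple u b n : P u -> P b -> u <=P b *+ n -> u != 0 ->
  exists w, [/\ P w, w <=P u, w <=P b & w != 0].
Proof.
move=> Pu Pb un u0; apply: contrapT => h; move/eqP: u0; apply.
have d : disjoint_elts b u.
  move=> w Pw wb wu; apply: contrapT => /eqP w0.
  by apply: h; exists w.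
have := disjoint_eltsZ Pb (natr_nonneg n) d.
by rewrite scaler_nat; apply => //; exact: cone_lexx.
Qed.

(** The remainders of [y *+ m] and [b *+ n] modulo their meet are disjoint; if
    neither vanished, each would have a nonzero part below [b]. *)
Lemma basic_comparable b y m n : P b -> basic_elt b -> P y -> y <=P b ->
  y *+ m <=P b *+ n \/ b *+ n <=P y *+ m.
Proof.
move=> Pb bb Py yb; have [c [c1 c2 c3 d]] := disjoint_diff (y *+ m) (b *+ n).
have Pc := c3 (coneMn m Py) (coneMn n Pb).
have sub_le z : z - c <=P z by rewrite /cone_le opprB addrC subrK.
have [e|u0] := eqVneq (y *+ m - c) 0.
  by left; move: c2; rewrite -(subrK c (y *+ m)) e add0r.
have [e|v0] := eqVneq (b *+ n - c) 0.
  by right; move: c1; rewrite -(subrK c (b *+ n)) e add0r.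
have um : y *+ m - c <=P b *+ m.
  apply: cone_le_trans (sub_le _) _.
  by rewrite -!scaler_nat; apply: cone_leZ => //; exact: natr_nonneg.
have [u [Pu u1 u2 un0]] := not_disjoint_multiple c1 Pb um u0.
have [v [Pv v1 v2 vn0]] := not_disjoint_multiple c2 Pb (sub_le _) v0.
have : disjoint_elts u v.
  apply: disjoint_elts_le u1 _; apply: disjoint_elts_sym.
  by apply: disjoint_elts_le v1 _; exact: disjoint_elts_sym.
case/(bb _ _ Pu Pv u2 v2) => e.
  by rewrite e eqxx in un0.
by rewrite e eqxx in vn0.
Qed.

Lemma basic_sandwich b y m : P b -> basic_elt b -> P y -> y <=P b ->
  exists n, b *+ n <=P y *+ m /\ y *+ m <=P b *+ n.+1.
Proof.
move=> Pb bb Py yb; elim: m => [|m [n [h1 h2]]].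
  exists 0%N; rewrite !mulr0n; split; first exact: cone_lexx.
  by rewrite cone_le0; exact: coneMn.
have h3 : y *+ m.+1 <=P b *+ n.+2.
  by rewrite !mulrS addrC; rewrite -mulrS [b + _]addrC; exact: cone_leD.
have h4 : b *+ n <=P y *+ m.+1.
  by rewrite mulrSr -[b *+ n]addr0; apply: cone_leD => //; rewrite cone_le0.
case: (basic_comparable m.+1 n.+1 Pb bb Py yb) => h; first by exists n.
by exists n.+1.
Qed.

(** Comparing multiples of [y] and [b] puts [m y - n b] between [0] and [b] for
    a suitable [n], for every [m].  Order intervals are bounded, so [y] and
    [b] have the same direction in the real vector space. *)
Lemma basic_proportional b y : P b -> basic_elt b -> P y -> y <=P b ->
  proportional y b.
Proof.
move=> Pb bb Py yb i j k l; have [B hB] := order_interval_bounded b.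
have h m : exists n, forall i j, `|val (y i j) *+ m - val (b i j) *+ n| <= B.
  have [n [h1 h2]] := basic_sandwich m Pb bb Py yb; exists n => i' j'.
  have : abs_le (y *+ m - b *+ n) b.
    apply/abs_leE; split; last exact: (lalg_add hP Pb h1).
    by move: h2; rewrite /cone_le mulrS opprB addrA.
  by move=> /hB/(_ i' j'); rewrite !(mxE, mulmxnE) rmorphB !rmorphMn.
apply: val_inj; apply/eqP; rewrite -subr_eq0 -normr_le0 !rmorphM.
set a := val (y i j); set c := val (b k l); set a' := val (y k l).
set c' := val (b i j).
apply: (@mulrn_bounded_le0 _ _ (B * `|c| + B * `|c'|)) => m; have [n hn] := h m.
rewrite -normrMn.
have -> : (a * c - a' * c') *+ m =
    (a *+ m - c' *+ n) * c - (a' *+ m - c *+ n) * c'.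
  rewrite mulrnBl !mulrBl !mulrnAl [c' * c]mulrC; ring.
apply: le_trans (ler_normB _ _) _; rewrite !normrM.
by apply: lerD; apply: ler_wpM2r => //; exact: hn.
Qed.

Lemma basic_proportional_multiple b y n : P b -> basic_elt b -> P y ->
  y <=P b *+ n -> proportional y b.
Proof.
move=> Pb bb; elim: n y => [|n IHn] y Py.
  rewrite mulr0n /cone_le sub0r => PNy.
  by rewrite (cone_eq0 Py PNy); exact: proportional0.
rewrite mulrS => /(riesz_decomposition Py Pb (coneMn n Pb)).
move=> [y1 [y2 [Py1 Py2 -> h1 h2]]].
by apply: proportionalD; [exact: basic_proportional|exact: IHn].
Qed.

(** For large [n] the meet [y] of [x] and [n b] no longer grows with [n],
    because its multiple of [b] stays bounded; so [y + w <= y] for any [w]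
    below both [x - y] and [b]. *)
Lemma basic_projection b x : P b -> b != 0 -> basic_elt b -> P x ->
  exists2 y, [/\ P y, y <=P x & proportional y b] & disjoint_elts (x - y) b.
Proof.
move=> Pb b0 bb Px; have [B hB] := order_interval_bounded x.
have [k [l bkl]] := matrix_neq0_entry b0.
have bkl' : val (b k l) != 0 by rewrite val_eq0R.
(* Every element between [0] and [x] that is a multiple of [b] is at most [n b];
   taking the meet with [n.+1] copies leaves room for one more [b]. *)
pose n := (Num.truncn (B / `|val (b k l)|)).+1.
have [y [yx yn yP]] := lalg_meet hP x (b *+ n.+1).
have Py : P y.
  by rewrite -cone_le0; apply: yP; rewrite cone_le0 //; exact: coneMn.
have pyb := basic_proportional_multiple Pb bb Py yn.
exists y => // w Pw wx wb; apply: cone_eq0 => //.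
suff : y + w <=P y by rewrite /cone_le opprD addNKr.
apply: yP; first by move: wx; rewrite /cone_le opprD addrA.
rewrite mulrSr; apply: cone_leD => //.
apply: (proportional_cone Pb _ bkl).
  by apply: proportionalB => //; exact: proportionalMn.
rewrite !mxE mulmxnE mulrBl rmorphB !rmorphM rmorphMn /= subr_ge0.
apply: le_trans (ler_norm _) _.
have -> : val (b k l) *+ n * val (b k l) = `|val (b k l)| *+ n * `|val (b k l)|.
  by rewrite !mulrnAl -expr2 -[in RHS]expr2 real_normK // num_real.
rewrite normrM; apply: ler_wpM2r => //.
have : abs_le y x by apply/abs_leE; split => //; exact: (lalg_add hP Px Py).
move=> /hB/(_ k l) /le_trans; apply.
by rewrite -[leRHS]mulr_natl -ler_pdivrMr ?normr_gt0 // ltW // truncnS_gt.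
Qed.

Definition disjoint_family (I : finType) (b : I -> 'M[R]_2) :=
  [/\ forall i, P (b i), forall i, b i != 0 &
      forall i j, i != j -> disjoint_elts (b i) (b j)].

(** In a relation [\sum_i c i *: b i = 0], the term [|c i| *: b i] lies below
    the sum of the [|c j| *: b j] over [j != i] while being disjoint from it. *)
Lemma disjoint_family_free (I : finType) (b : I -> 'M[R]_2) (c : I -> R) :
  disjoint_family b -> \sum_i c i *: b i = 0 -> forall i, c i = 0.
Proof.
move=> [Pb b0 db] h i; pose T := \sum_(j | j != i) absR (c j) *: b j.
have Pabs j : P (absR (c j) *: b j) by apply: lalg_scale => //; exact: absR_nonneg.
have d : disjoint_elts (absR (c i) *: b i) T.
  apply: disjoint_elts_sym; apply: disjoint_elts_sum => // j ji.
  apply: disjoint_eltsZ => //; first exact: absR_nonneg.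
  apply: disjoint_elts_sym; apply: disjoint_eltsZ => //; first exact: absR_nonneg.
  by apply: db; rewrite eq_sym.
have le1 j : abs_le (c j *: b j) (absR (c j) *: b j).
  by apply: abs_leZ; apply/abs_leE; rewrite subrr;
     split; [exact: cone0|exact: (lalg_add hP)].
have leT : abs_le (c i *: b i) T.
  move: h; rewrite (bigD1 i) //= => /eqP; rewrite addr_eq0 => /eqP ->.
  by apply: abs_leN; apply: abs_le_sum.
have : absR (c i) *: b i <=P T.
  have [h1 h2] := leT; rewrite /absR; case: ifP => // _.
  by move: h2; rewrite /cone_le opprK scaleNr opprK addrC.
move=> /(d _ (Pabs i) (cone_lexx _)) e0.
have [k [l bkl]] := matrix_neq0_entry (b0 i).
move/matrixP/(_ k l)/eqP: e0; rewrite !mxE mulf_eq0 (negPf bkl) orbF.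
by rewrite /absR; case: ifP => _; rewrite ?oppr_eq0 => /eqP.
Qed.

(** More than four coordinate vectors of length four, padded with zeros to a
    square matrix, have a zero column and hence a linear relation over [R]. *)
Lemma disjoint_family_card (I : finType) (b : I -> 'M[R]_2) :
  disjoint_family b -> (#|I| <= 4)%N.
Proof.
move=> fb; rewrite leqNgt; apply/negP => I4.
pose A : 'M[R]_#|I| := \matrix_(i, j)
  if (j < 4)%N then mxvec (b (enum_val i)) 0 (inord j : 'I_(2 * 2).-1.+1) else 0.
have /det0P[v v0 vA] : \det A == 0.
  rewrite -det_tr; apply/det0P; exists (delta_mx 0 (Ordinal I4)).
    apply/eqP => /matrixP/(_ 0 (Ordinal I4))/eqP.
    by rewrite !mxE !eqxx oner_eq0.
  by rewrite -rowE; apply/matrixP => i j; rewrite !mxE ltnn.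
have [i0 [j vj]] := matrix_neq0_entry v0; rewrite ord1 in vj.
have /(disjoint_family_free fb) : \sum_i v 0 (enum_rank i) *: b i = 0.
  apply: (can_inj mxvecK); rewrite linear_sum linear0.
  apply/matrixP => i0' q; rewrite ord1 !mxE summxE.
  have q4 : (q < #|I|)%N by exact: ltn_trans (ltn_ord q) I4.
  move/matrixP/(_ 0 (Ordinal q4)): vA; rewrite !mxE => vA.
  rewrite -[RHS]vA (reindex (@enum_val I predT)) /=; last first.
    exact: (onW_bij _ (enum_val_bij _)).
  apply: eq_bigr => i _; rewrite linearZ !mxE /= ltn_ord enum_valK.
  by congr (_ * mxvec _ 0 _); apply: val_inj; rewrite /= inordK.
by move=> /(_ (enum_val j)) /eqP; rewrite enum_valK (negPf vj).
Qed.

Lemma maximal_disjoint_family : exists (I : finType) (b : I -> 'M[R]_2),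
  disjoint_family b /\
  forall (J : finType) (c : J -> 'M[R]_2), disjoint_family c -> (#|J| <= #|I|)%N.
Proof.
pose p n := `[< exists (I : finType) (b : I -> 'M[R]_2),
  disjoint_family b /\ #|I| = n >].
have p0 : exists n, p n.
  exists 0%N; apply/asboolP; exists void, (fun=> 0).
  by split; [split=> -[]|rewrite card_void].
have p4 n : p n -> (n <= 4)%N.
  by move/asboolP => [I [b [fb <-]]]; exact: disjoint_family_card fb.
case: (ex_maxnP p0 p4) => n /asboolP[I [b [fb <-]]] nmax.
exists I, b; split=> // J c fc; apply: nmax.
by apply/asboolP; exists J, c.
Qed.

Section MaximalFamily.
Variables (I : finType) (b : I -> 'M[R]_2) (fb : disjoint_family b).
Hypothesis b_max : forall (J : finType) (c : J -> 'M[R]_2),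
  disjoint_family c -> (#|J| <= #|I|)%N.

Lemma maximal_family_complete x : P x ->
  (forall i, disjoint_elts x (b i)) -> x = 0.
Proof.
case: fb => Pb b0 db Px dx; apply: contrapT => /eqP x0.
have := b_max (c := oapp b x); rewrite card_option ltnn => /(_ _) F.
suff /F : disjoint_family (oapp b x) by [].
split=> [[i|]|[i|]|[i|] [j|]] //= ij; first exact: db.
exact: disjoint_elts_sym.
Qed.

(** Two disjoint nonzero elements below a member could replace it. *)
Lemma maximal_family_basic i : basic_elt (b i).
Proof.
case: fb => Pb b0 db u v Pu Pv ub vb duv.
have [->|u0] := eqVneq u 0; first by left.
have [->|v0] := eqVneq v 0; first by right.
pose c := oapp (fun j => if j == i then u else b j) v.
have := b_max (c := c); rewrite card_option ltnn => F.
suff /F : disjoint_family c by [].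
have db' w j : w <=P b i -> j != i -> disjoint_elts w (b j).
  by move=> wb ji; apply: disjoint_elts_le wb _; apply: db; rewrite eq_sym.
split=> [[j|]|[j|]|[j|] [k|]] //=; do ?[by case: ifP].
- have [-> |ji] := eqVneq j i; have [-> |ki] := eqVneq k i => //= jk.
  + by rewrite eqxx in jk.
  + exact: db'.
  + by apply: disjoint_elts_sym; exact: db'.
  + by apply: db; exact: contra jk => /eqP ->.
- have [_|ji] := eqVneq j i => // _.
  by apply: disjoint_elts_sym; exact: db'.
- have [_|ji] := eqVneq k i => // _; first exact: disjoint_elts_sym.
  exact: db'.
Qed.

(** Projecting successively on the lines of the family leaves a remainder
    disjoint from every member. *)
Lemma maximal_family_decomposition x : P x -> exists X : I -> 'M[R]_2,
  (forall i, P (X i) /\ proportional (X i) (b i)) /\ x = \sum_i X i.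
Proof.
case: (fb) => Pb b0 db Px.
suff H (s : seq I) : exists X : I -> 'M[R]_2, exists x',
    [/\ forall i, P (X i) /\ proportional (X i) (b i), x = \sum_i X i + x',
        P x' & forall i, i \in s -> disjoint_elts x' (b i)].
  have [X [x' [hX xE Px' dx']]] := H (enum I); exists X; split=> //.
  rewrite {1}xE (@maximal_family_complete x') ?addr0 // => i.
  by apply: dx'; rewrite mem_enum.
elim: s => [|i s [X [x' [hX xE Px' dx']]]].
  exists (fun=> 0), x; split=> //; last by rewrite big1 ?add0r.
  by move=> i; split; [exact: cone0|exact: proportional0].
have [y [Py yx py] dy] :=
  basic_projection (Pb i) (b0 i) (@maximal_family_basic i) Px'.
exists (fun j => X j + (if j == i then y else 0)), (x' - y); split=> //.
- move=> j; have [PX pX] := hX j; case: eqP => [->|_]; last by rewrite addr0.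
  by have [PXi pXi] := hX i; split; [exact: lalg_add|exact: proportionalD].
- by rewrite big_split /= -big_mkcond big_pred1_eq xE addrA addrAC addrK.
- move=> j; rewrite inE => /orP[/eqP -> //|js].
  apply: disjoint_elts_le (dx' _ js).
  by rewrite /cone_le opprB addrC subrK.
Qed.

End MaximalFamily.

Lemma cone_decomposition : exists (I : finType) (b : I -> 'M[R]_2),
  [/\ forall i, P (b i), forall i, b i != 0, (#|I| <= 4)%N &
   forall x, P x -> exists X : I -> 'M[R]_2,
    (forall i, P (X i) /\ proportional (X i) (b i)) /\ x = \sum_i X i].
Proof.
have [I [b [fb b_max]]] := maximal_disjoint_family; exists I, b.
case: (fb) => Pb b0 _; split=> //; first exact: disjoint_family_card fb.
exact: maximal_family_decomposition.
Qed.

End OrderedCone.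
(** * Simplicial cones of real matrices closed under products *)

(** The extension of [P] to real scalars, presented by generators of its rays;
    carrying the coordinates [beta] along turns positivity into inequalities. *)
Record positive_basis (K : realType) (I : finType) (b : I -> 'M[K]_2)
    (beta : I -> 'M[K]_2 -> K) : Prop := PositiveBasis {
  positive_basis_lin : forall i, scalar (beta i);
  positive_basis_dual : forall i j, beta i (b j) = (i == j)%:R;
  positive_basis_span : forall x, x = \sum_i beta i x *: b i;
  positive_basis_mul : forall i j k, 0 <= beta k (b i *m b j)
}.

(** Transposition exchanges left and right ideals, so one-sided results come in
    pairs. *)
Lemma positive_basis_tr (K : realType) (I : finType) (b : I -> 'M[K]_2)
    (beta : I -> 'M[K]_2 -> K) : positive_basis b beta ->
  positive_basis (fun i => (b i)^T) (fun i x => beta i x^T).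
Proof.
move=> [lin dual span mul]; split.
- by move=> i a x y; rewrite linearP; exact: lin.
- by move=> i j; rewrite trmxK.
- by move=> x; apply: trmx_inj; rewrite [LHS]span linear_sum; apply: eq_bigr => i _;
    rewrite linearZ /= trmxK.
- by move=> i j k; rewrite trmx_mul !trmxK.
Qed.

Section SimplicialCone.
Variables (K : realType) (I : finType) (b : I -> 'M[K]_2).
Variables (beta : I -> 'M[K]_2 -> K) (hb : positive_basis b beta).
Let beta_lin := positive_basis_lin hb.
Let beta_b := positive_basis_dual hb.
Let b_span := positive_basis_span hb.
Let beta_bM := positive_basis_mul hb.
Implicit Types (x y z p q : 'M[K]_2).

Lemma betaD i x y : beta i (x + y) = beta i x + beta i y.
Proof. by have := beta_lin i 1 x y; rewrite scale1r mul1r. Qed.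

Lemma beta0 i : beta i 0 = 0.
Proof. by apply: (addrI (beta i 0)); rewrite -betaD !addr0. Qed.

Lemma betaZ i a x : beta i (a *: x) = a * beta i x.
Proof. by have := beta_lin i a x 0; rewrite !addr0 beta0 addr0. Qed.

Lemma betaN i x : beta i (- x) = - beta i x.
Proof. by rewrite -scaleN1r betaZ mulN1r. Qed.

Lemma betaB i x y : beta i (x - y) = beta i x - beta i y.
Proof. by rewrite betaD betaN. Qed.

Lemma beta_sum i (J : finType) (F : J -> 'M[K]_2) :
  beta i (\sum_j F j) = \sum_j beta i (F j).
Proof.
by elim/big_ind2: _ => //; [exact: beta0|move=> x ? y ? <- <-; exact: betaD].
Qed.

Lemma beta_comb i (c : I -> K) : beta i (\sum_j c j *: b j) = c i.
Proof.
rewrite beta_sum (bigD1 i) //= big1 ?addr0 ?betaZ ?beta_b ?eqxx ?mulr1 //.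
by move=> j ji; rewrite betaZ beta_b eq_sym (negPf ji) mulr0.
Qed.

Definition pos x := forall i, 0 <= beta i x.

Lemma posD x y : pos x -> pos y -> pos (x + y).
Proof. by move=> hx hy i; rewrite betaD addr_ge0. Qed.

Lemma posZ a x : 0 <= a -> pos x -> pos (a *: x).
Proof. by move=> a0 hx i; rewrite betaZ mulr_ge0. Qed.

Lemma pos_b i : pos (b i).
Proof. by move=> j; rewrite beta_b. Qed.

Lemma pos_sum (J : finType) (F : J -> 'M[K]_2) :
  (forall j, pos (F j)) -> pos (\sum_j F j).
Proof. by move=> h i; rewrite beta_sum; apply: sumr_ge0 => j _; exact: h. Qed.

Lemma posM x y : pos x -> pos y -> pos (x *m y).
Proof.
move=> hx hy; rewrite (b_span x) (b_span y) mulmx_suml; apply: pos_sum => i.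
rewrite mulmx_sumr; apply: pos_sum => j.
rewrite -scalemxAl -scalemxAr scalerA; apply: posZ; first exact: mulr_ge0.
by move=> k.
Qed.

Lemma beta_eq0 x : (forall i, beta i x = 0) -> x = 0.
Proof.
by move=> h; rewrite (b_span x) big1 // => i _; rewrite h scale0r.
Qed.

Lemma pos_eq0 x : pos x -> pos (- x) -> x = 0.
Proof.
move=> h h'; apply: beta_eq0 => i; apply/eqP; rewrite eq_le h andbT.
by have := h' i; rewrite betaN oppr_ge0.
Qed.

Lemma beta_neq0 x : x != 0 -> exists i, beta i x != 0.
Proof.
move=> x0; apply: contrapT => h; move/eqP: x0; apply; apply: beta_eq0 => i.
by apply: contrapT => /eqP hi; apply: h; exists i.
Qed.

Lemma pos_scalar_ge0 a x : x != 0 -> pos x -> pos (a *: x) -> 0 <= a.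
Proof.
move=> x0 hx hax; have [i xi] := beta_neq0 x0.
by have := hax i; rewrite betaZ pmulr_lge0 // lt_def xi hx.
Qed.

Lemma pos_parts x : exists p q, [/\ pos p, pos q & x = p - q].
Proof.
exists (\sum_i Num.max (beta i x) 0 *: b i), (\sum_i Num.max (- beta i x) 0 *: b i).
split; try by move=> j; rewrite beta_comb le_max lexx orbT.
rewrite {1}(b_span x) -sumrB; apply: eq_bigr => i _.
rewrite -scalerBl; congr (_ *: _).
case: (lerP (beta i x) 0) => h.
  by rewrite max_l ?oppr_ge0 // sub0r opprK.
by rewrite max_r ?subr0 // oppr_le0 ltW.
Qed.

(** ** Positive matrices have real eigenvalues *)

(** By Cayley-Hamilton [\det p *: p = \tr p *: p ^ 2 - p ^ 3], which is negative
    when the trace is nonpositive. *)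
Lemma pos_det_gt0_trace p : pos p -> p != 0 -> 0 < \det p -> 0 < \tr p.
Proof.
move=> hp p0 dp; rewrite ltNge; apply/negP => tp.
move/eqP: p0; apply; apply: pos_eq0 => //.
suff : pos (\det p *: - p).
  by move=> /(posZ (ltW (eqbRL (invr_gt0 _) dp))); rewrite scalerA mulVf ?scale1r ?gt_eqF.
have -> : \det p *: - p = p *m p *m p + (- \tr p) *: (p *m p).
  rewrite {1}cayley_hamilton2 mulmxBl -scalemxAl mul_scalar_mx.
  by rewrite scaleNr addrAC subrr add0r scalerN.
have hpp := posM hp hp; apply: posD; first exact: posM.
by apply: posZ; rewrite ?oppr_ge0.
Qed.

(** Squaring at least doubles the relative gap between the squared trace and four times
    the determinant, until the trace becomes nonpositive. *)
Lemma pos_discriminant_ge0 p : pos p -> p != 0 -> 4 * \det p <= \tr p ^+ 2.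
Proof.
move=> hp p0; rewrite leNgt; apply/negP => hlt.
have main n : forall p, pos p -> p != 0 -> \tr p ^+ 2 < 4 * \det p ->
    4 * \det p <= 2 ^+ n * (4 * \det p - \tr p ^+ 2) -> False.
  elim: n => [|n IHn] {hlt p hp p0} p hp p0 hlt hn.
    have t0 : \tr p = 0.
      apply/eqP; rewrite -sqrf_eq0 eq_le sqr_ge0 andbT.
      by move: hn; rewrite expr0 mul1r; lra.
    have d0 : 0 < \det p by move: hlt; rewrite t0 expr0n /=; lra.
    by have := pos_det_gt0_trace hp p0 d0; rewrite t0 ltxx.
  have d0 : 0 < \det p by have := sqr_ge0 (\tr p); lra.
  have t0 := pos_det_gt0_trace hp p0 d0.
  have d0' : 0 < \det (p *m p) by rewrite det_mulmx mulr_gt0.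
  have pp0 : p *m p != 0.
    by apply: contraTneq d0' => ->; rewrite det0 ltxx.
  have t0' := pos_det_gt0_trace (posM hp hp) pp0 d0'.
  apply: (IHn _ (posM hp hp) pp0).
    rewrite mxtrace_mul_self det_mulmx.
    move: (\tr p) (\det p) hlt d0 t0 => t d hlt d0 t0.
    have : 0 < t ^+ 2 * (4 * d - t ^+ 2) by rewrite mulr_gt0 ?exprn_gt0 // subr_gt0.
    nra.
  move: t0'; rewrite mxtrace_mul_self det_mulmx.
  move: (\tr p) (\det p) hlt hn d0 t0 => t d hlt hn d0 t0 t0'.
  have -> : 4 * (d * d) - (t ^+ 2 - 2 * d) ^+ 2 = t ^+ 2 * (4 * d - t ^+ 2) by ring.
  have c0 : 0 <= 2 ^+ n * (4 * d - t ^+ 2).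
    by rewrite mulr_ge0 ?exprn_ge0 // subr_ge0 ltW.
  rewrite [leRHS]mulrCA; apply: (@le_trans _ _ (2 * d * (2 ^+ n * (4 * d - t ^+ 2)))).
    have := ler_wpM2l (ltW d0) hn; rewrite exprS; lra.
  by apply: ler_wpM2r => //; lra.
have e0 : 0 < 4 * \det p - \tr p ^+ 2 by rewrite subr_gt0.
apply: (main (Num.truncn (4 * \det p / (4 * \det p - \tr p ^+ 2))).+1 p) => //.
rewrite -ler_pdivrMr //; apply: (le_trans (ltW (truncnS_gt _))).
by rewrite -natrX ler_nat ltnW // ltn_expl.
Qed.

(** Otherwise the quadratic form [\tr x ^+ 2 - 4 * \det x] vanishes on the cone,
    hence everywhere, since the cone generates the space. *)
Lemma exists_pos_discriminant_gt0 : exists2 p, pos p & 4 * \det p < \tr p ^+ 2.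
Proof.
apply: contrapT => h.
have h0 p : pos p -> \tr p ^+ 2 - 4 * \det p = 0.
  move=> hp; apply/eqP; rewrite subr_eq0; have [->|p0] := eqVneq p 0.
    by rewrite mxtrace0 det0 mulr0 expr0n.
  rewrite eq_le pos_discriminant_ge0 // andbT leNgt; apply/negP => hlt.
  by apply: h; exists p.
have [p [q [hp hq e]]] := pos_parts (delta_mx 0 0).
have : \tr (p - q) ^+ 2 - 4 * \det (p - q) = 0.
  have := h0 _ hp; have := h0 _ hq; have := h0 _ (posD hp hq).
  rewrite !mxtrace2E !det2E !mxE => h1 h2 h3; nra.
rewrite -e mxtrace2E det2E !mxE /= addr0 mulr0 mul0r subrr mulr0 subr0 expr1n.
by move/eqP; rewrite oner_eq0.
Qed.

(** Squaring makes a nonzero trace positive.  For trace zero, [p *m p] is a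
    positive multiple of [1], and [p + 1] has trace [2]. *)
Lemma exists_pos_dominant :
  exists p, [/\ pos p, 4 * \det p < \tr p ^+ 2 & 0 < \tr p].
Proof.
have [p hp dp] := exists_pos_discriminant_gt0.
have [t0|t0] := eqVneq (\tr p) 0; last first.
  have t20 : 0 < \tr p ^+ 2 by rewrite lt_def sqrf_eq0 t0 sqr_ge0.
  exists (p *m p); split; first exact: posM.
    rewrite mxtrace_mul_self det_mulmx.
    move: (\tr p) (\det p) dp t20 => t d dp t20.
    have : 0 < t ^+ 2 * (t ^+ 2 - 4 * d) by rewrite mulr_gt0 // subr_gt0.
    nra.
  rewrite mxtrace_mul_self; lra.
have d0 : \det p < 0 by move: dp; rewrite t0 expr0n /=; lra.
have h1 : pos 1%:M.
  have -> : 1%:M = (- \det p)^-1 *: (p *m p).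
    rewrite cayley_hamilton2 t0 scale0r sub0r -(scalemx1 _ (\det p)) -scaleNr.
    by rewrite scalerA mulVf ?scale1r // oppr_eq0 lt_eqF.
  apply: posZ; last exact: posM.
  by rewrite invr_ge0 oppr_ge0 ltW.
exists (p + 1%:M); split; first exact: posD.
  move: t0 d0; rewrite !mxtrace2E !det2E !mxE /= => t0 d0; nra.
by rewrite mxtraceD t0 mxtrace1 add0r.
Qed.

(** With eigenvalues [mu < la] such that [|mu| < la], the matrix [p - mu] is
    the limit of the multiples [(la - mu) / la ^ n] of the powers of [p]. *)
Lemma exists_pos_singular : exists x, [/\ pos x, x != 0 & \det x = 0].
Proof.
have [p [hp dp tp]] := exists_pos_dominant.
pose s := Num.sqrt (\tr p ^+ 2 - 4 * \det p).
have s0 : 0 < s by rewrite sqrtr_gt0 subr_gt0.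
have sE : s ^+ 2 = \tr p ^+ 2 - 4 * \det p by rewrite sqr_sqrtr // subr_ge0 ltW.
pose la := (\tr p + s) / 2; pose mu := (\tr p - s) / 2.
have la0 : 0 < la by rewrite /la; lra.
have lamu : mu < la by rewrite /la /mu; lra.
have laD : la + mu = \tr p by rewrite /la /mu; lra.
have laM : la * mu = \det p.
  suff : 4 * (la * mu) = 4 * \det p by lra.
  have -> : 4 * (la * mu) = \tr p ^+ 2 - s ^+ 2 by rewrite /la /mu; field.
  by rewrite sE; ring.
pose x := p - mu%:M; pose y := p - la%:M.
have CH : p *m p = (la + mu) *: p - (la * mu)%:M by rewrite cayley_hamilton2 laD laM.
have px : p *m x = la *: x.
  rewrite mulmxBr CH mul_mx_scalar scalerDl /x scalerBr scale_scalar_mx.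
  by rewrite addrAC addrK.
have py : p *m y = mu *: y.
  rewrite mulmxBr CH mul_mx_scalar scalerDl /y scalerBr scale_scalar_mx.
  by rewrite [mu * la]mulrC [la *: p + _]addrC addrAC addrK.
exists x; split.
- have [mu0|mu0] := lerP mu 0.
    have -> : x = la^-1 *: (p *m p + (- mu) *: p).
      rewrite scaleNr -(mul_mx_scalar mu p) -mulmxBr px scalerA mulVf ?scale1r //.
      by rewrite gt_eqF.
    apply: posZ; first by rewrite invr_ge0 ltW.
    by apply: posD; [exact: posM|apply: posZ; rewrite ?oppr_ge0].
  have h n : pos (la ^+ n.+1 *: x - mu ^+ n.+1 *: y).
    elim: n => [|n IHn].
      have -> : la ^+ 1 *: x - mu ^+ 1 *: y = (la - mu) *: p.
        rewrite !expr1 /x /y !scalerBr !scale_scalar_mx [mu * la]mulrC.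
        by rewrite scalerBl opprB addrA subrK.
      by apply: posZ => //; rewrite subr_ge0 ltW.
    have -> : la ^+ n.+2 *: x - mu ^+ n.+2 *: y =
        p *m (la ^+ n.+1 *: x - mu ^+ n.+1 *: y).
      by rewrite mulmxBr -!scalemxAr px py !scalerA -!exprSr.
    exact: posM.
  move=> i; apply: (@geometric_limit_ge0 _ _ (beta i y) (mu / la)).
  + by rewrite divr_ge0 // ltW.
  + by rewrite ltr_pdivrMr // mul1r.
  + move=> n; have := h n i; rewrite betaB !betaZ subr_ge0 => hn.
    rewrite expr_div_n mulrAC ler_pdivrMr ?exprn_gt0 //.
    by rewrite [leRHS]mulrC.
- apply/eqP => x0; move: dp.
  have -> : p = mu%:M by apply/eqP; rewrite -subr_eq0; apply/eqP.
  by rewrite det_scalar mxtrace_scalar (_ : (mu *+ 2) ^+ 2 = 4 * mu ^+ 2) ?ltxx //; ring.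
(* Determinants in [p *m x = la *: x] give [la ^+ 2 * \det x = la * mu * \det x]. *)
- have hx : \det (la *: x) = \det p * \det x by rewrite -px det_mulmx.
  apply: (@mulfI _ (la * (la - mu))).
    by rewrite mulf_neq0 ?subr_eq0 // gt_eqF.
  rewrite mulr0 mulrBr mulrBl laM -hx detZ expr2; exact: subrr.
Qed.

(** ** Extreme rays of the cone *)

(** [x] spans an extreme ray. *)
Definition extreme x := forall y k, pos y -> pos (k *: x - y) -> exists c, y = c *: x.

(** Extremality tested only inside the left ideal of [x], where all elements are
    singular when [x] is; [right_extreme] is its mirror image. *)
Definition left_extreme x := forall a k, pos (a *m x) ->
  pos (k *: x - a *m x) -> exists c, a *m x = c *: x.

Definition right_extreme x := forall a k, pos (x *m a) ->
  pos (k *: x - x *m a) -> exists c, x *m a = c *: x.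

Lemma extreme_b i : extreme (b i).
Proof.
move=> y k hy hk; exists (beta i y); rewrite {1}(b_span y).
rewrite (bigD1 i) //= big1 ?addr0 // => j ji.
suff -> : beta j y = 0 by rewrite scale0r.
apply/eqP; rewrite eq_le hy andbT.
by have := hk j; rewrite betaB betaZ beta_b (negPf ji) mulr0 sub0r oppr_ge0.
Qed.

Lemma b_neq0 i : b i != 0.
Proof.
apply/eqP => bi; have := beta_b i i; rewrite bi beta0 eqxx => /esym/eqP.
by rewrite oner_eq0.
Qed.

Lemma extreme_left_right x : extreme x -> left_extreme x /\ right_extreme x.
Proof. by move=> h; split=> a k; exact: h. Qed.

Lemma extreme_basis_multiple x : pos x -> x != 0 -> extreme x ->
  exists i c, 0 < c /\ x = c *: b i.
Proof.
move=> hx x0 ex; have [i xi] := beta_neq0 x0.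
have [||c ec] := ex (beta i x *: b i) 1; first exact: posZ (pos_b i).
  move=> j; rewrite scale1r betaB betaZ beta_b.
  by case: eqVneq => [->|_]; rewrite ?mulr1 ?subrr // mulr0 subr0.
have xc : beta i x = c * beta i x.
  by rewrite -betaZ -ec betaZ beta_b eqxx mulr1.
exists i, (beta i x); split; first by rewrite lt_def xi hx.
by rewrite ec; move/eqP: xc; rewrite -subr_eq0 -{1}[beta i x]mul1r -mulrBl
  mulf_eq0 (negPf xi) orbF subr_eq0 => /eqP <-; rewrite scale1r.
Qed.

Lemma multiple_of_pos_multiple (F : 'M[K]_2 -> 'M[K]_2) x :
  (forall p q, F (p - q) = F p - F q) ->
  (forall p, pos p -> exists c, F p = c *: x) ->
  forall p, exists c, F p = c *: x.
Proof.
move=> FB h p; have [p1 [p2 [h1 h2 ->]]] := pos_parts p.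
have [c1 e1] := h _ h1; have [c2 e2] := h _ h2.
by exists (c1 - c2); rewrite FB e1 e2 scalerBl.
Qed.

(** All [y *m p *m x] lie on the line of [x]; write [1] as a sum of products
    [p *m x *m q]. *)
Lemma dominated_right_multiple x y : x != 0 -> pos x -> left_extreme x -> pos y ->
  (forall p, pos p -> exists k, pos (k *: x - y *m p *m x)) ->
  exists r, y = x *m r.
Proof.
move=> x0 hx ex hy h.
have {}h p : exists c, y *m p *m x = c *: x.
  apply: (@multiple_of_pos_multiple (fun p => y *m p *m x)) => {}p => [q|hp].
    by rewrite mulmxBr mulmxBl.
  by have [k hk] := h p hp; apply: (ex _ k) => //; apply: posM => //; apply: posM.
have [p [q e]] := one_in_ideal x0.
have /choice[c hc] : forall k, exists c, y *m p k *m x = c *: x by move=> k; exact: h.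
exists (\sum_k c k *: q k); rewrite -[LHS]mulmx1 e !mulmx_sumr.
by apply: eq_bigr => k _; rewrite !mulmxA hc -scalemxAl scalemxAr.
Qed.

Lemma dominated_left_multiple x y : x != 0 -> pos x -> right_extreme x -> pos y ->
  (forall p, pos p -> exists k, pos (k *: x - x *m p *m y)) ->
  exists r, y = r *m x.
Proof.
move=> x0 hx ex hy h.
have {}h p : exists c, x *m p *m y = c *: x.
  apply: (@multiple_of_pos_multiple (fun p => x *m p *m y)) => {}p => [q|hp].
    by rewrite mulmxBr mulmxBl.
  have [k hk] := h p hp; rewrite -mulmxA; apply: (ex _ k); rewrite mulmxA //.
  by apply: posM => //; apply: posM.
have [p [q e]] := one_in_ideal x0.
have /choice[c hc] : forall k, exists c, x *m q k *m y = c *: x by move=> k; exact: h.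
exists (\sum_k c k *: p k); rewrite -[LHS]mul1mx e !mulmx_suml.
by apply: eq_bigr => k _; rewrite -!mulmxA [x *m _]mulmxA hc -scalemxAl scalemxAr.
Qed.

(** If [y <= k x] with [x] singular, then [y *m p *m x] and [x *m p *m y] lie
    below multiples of [x], which makes [y] a multiple of [x] on both sides. *)
Lemma left_right_extreme x : pos x -> x != 0 -> \det x = 0 ->
  left_extreme x -> right_extreme x -> extreme x.
Proof.
move=> hx x0 dx lx rx y k hy hk.
have bound p : pos p -> pos ((k * \tr (x *m p)) *: x - y *m p *m x) /\
    pos ((k * \tr (x *m p)) *: x - x *m p *m y).
  move=> hp; rewrite -scalerA -singular_sandwich //; split.
    by rewrite !scalemxAl -!mulmxBl; apply: posM => //; apply: posM.
  by rewrite scalemxAr -mulmxBr; apply: posM => //; apply: posM.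
have [|r yr] := dominated_right_multiple x0 hx lx hy.
  by move=> p /bound[]; exists (k * \tr (x *m p)).
have [|r' yr'] := dominated_left_multiple x0 hx rx hy.
  by move=> p /bound[]; exists (k * \tr (x *m p)).
have [p px] := singular_fixed dx x0.
exists (\tr (x *m (r *m p))); rewrite -singular_sandwich // !mulmxA -yr.
by rewrite [in LHS]yr' -[in LHS]px !mulmxA -yr'.
Qed.

Definition supp x := [set i | 0 < beta i x]%SET.

(** Subtracting from [x] the largest multiple of [y] keeps it positive and
    kills one coordinate. *)
Lemma pos_sub_max x y k : pos y -> y != 0 -> pos (k *: x - y) -> pos x ->
  exists2 t, 0 < t & pos (x - t *: y) /\ (#|supp (x - t *: y)| < #|supp x|)%N.
Proof.
move=> hy y0 hk hx.
have [i0 yi0] := beta_neq0 y0.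
have {}yi0 : 0 < beta i0 y by rewrite lt_def yi0 hy.
have xy i : 0 < beta i y -> 0 < beta i x.
  move=> yi; rewrite lt_def hx andbT; apply/eqP => xi.
  by have := hk i; rewrite betaB betaZ xi mulr0 sub0r oppr_ge0 leNgt yi.
pose r i := beta i x / beta i y.
case: (@arg_minP _ _ I i0 (fun i => 0 < beta i y) r yi0) => i yi imin.
exists (r i); first by rewrite divr_gt0 // xy.
have hpos : pos (x - r i *: y).
  move=> j; rewrite betaB betaZ subr_ge0.
  have [yj|] := boolP (0 < beta j y); first by rewrite -ler_pdivlMr //; exact: imin.
  rewrite lt_def hy andbT negbK => /eqP ->; by rewrite mulr0.
split=> //; apply: proper_card; apply/properP; split.
  apply/fintype.subsetP => j; rewrite !inE betaB betaZ subr_gt0; apply: le_lt_trans.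
  by rewrite mulr_ge0 // divr_ge0 // ?ltW // xy.
exists i; rewrite !inE ?xy // betaB betaZ /r divfK ?gt_eqF //.
by rewrite subrr ltxx.
Qed.

(** A singular positive matrix of least support cannot lose a coordinate within
    its left or right ideal, whose members are all singular. *)
Lemma exists_extreme_singular : exists i, \det (b i) = 0.
Proof.
pose p n := `[< exists x, [/\ pos x, x != 0, \det x = 0 & #|supp x| = n] >].
have [|n /asboolP[x [hx x0 dx nE]] nmin] := @ex_minnP p.
  have [x [hx x0 dx]] := exists_pos_singular.
  by exists #|supp x|; apply/asboolP; exists x.
have key y k : pos y -> (forall t, \det (x - t *: y) = 0) -> pos (k *: x - y) ->
    exists c, y = c *: x.
  move=> hy dy hk; have [->|y0] := eqVneq y 0; first by exists 0; rewrite scale0r.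
  have [t t0 [ht st]] := pos_sub_max hy y0 hk hx.
  have [e|ne] := eqVneq (x - t *: y) 0.
    exists t^-1; move/eqP: e; rewrite subr_eq0 => /eqP ->.
    by rewrite scalerA mulVf ?scale1r // gt_eqF.
  suff /nmin : p #|supp (x - t *: y)| by rewrite -nE leqNgt st.
  by apply/asboolP; exists (x - t *: y).
have ex : extreme x.
  apply: left_right_extreme => // a k ha; apply: key => // t.
    by rewrite scalemxAl -{1}[x]mul1mx -mulmxBl det_mulmx dx mulr0.
  by rewrite scalemxAr -{1}[x]mulmx1 -mulmxBr det_mulmx dx mul0r.
have [i [c [c0 xc]]] := extreme_basis_multiple hx x0 ex.
exists i; apply/eqP; move/eqP: dx; rewrite xc detZ mulf_eq0 expf_eq0 /=.
by rewrite gt_eqF.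
Qed.
(** If [p *m b m] has a component along [b s], that component is dominated
    within the left ideal of [b m], so [b s] lies in this ideal.  The ideal is not
    a line, so some such [b s] is not proportional to [b m]. *)
Lemma left_neighbour m : \det (b m) = 0 ->
  exists n r, b n = r *m b m /\ forall c, b n != c *: b m.
Proof.
move=> dm; have b0 := b_neq0.
have hS p s : pos p -> 0 < beta s (p *m b m) -> exists r, b s = r *m b m.
  move=> hp hs; have hpx : pos (p *m b m) by apply: posM => //; exact: pos_b.
  have hd : pos (p *m b m - beta s (p *m b m) *: b s).
    move=> j; rewrite betaB betaZ beta_b.
    by case: eqVneq => [->|_]; rewrite ?mulr1 ?subrr // mulr0 subr0.
  apply: (dominated_left_multiple (b0 m) (pos_b m) _ (pos_b s)).
    by have [] := extreme_left_right (@extreme_b m).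
  move=> q hq; exists ((beta s (p *m b m))^-1 * \tr (b m *m (q *m p))).
  rewrite -scalerA -singular_sandwich //.
  have -> : b m *m q *m b s = (beta s (p *m b m))^-1 *:
      (b m *m q *m (beta s (p *m b m) *: b s)).
    by rewrite -scalemxAr scalerA mulVf ?scale1r // gt_eqF.
  rewrite -scalerBr mulmxA -[in X in X - _]mulmxA -mulmxBr.
  apply: posZ; first by rewrite invr_ge0 ltW.
  apply: posM => //; apply: posM => //; exact: pos_b.
apply: contrapT => H.
have {}H s : (exists r, b s = r *m b m) -> exists c, b s = c *: b m.
  move=> [r hr]; apply: contrapT => H'; apply: H; exists s, r; split=> // c.
  by apply/eqP => e; apply: H'; exists c.
have [p hp] := not_all_left_multiples (b0 m).
have [|q hq|c /eqP] := @multiple_of_pos_multiple (fun p => p *m b m) (b m) _ _ p.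
- by move=> ? ?; rewrite mulmxBl.
- have /choice[c hc] : forall s, exists c, beta s (q *m b m) *: b s = c *: b m.
    move=> s; have [e|qs] := eqVneq (beta s (q *m b m)) 0.
      by exists 0; rewrite e !scale0r.
    have hqs : 0 < beta s (q *m b m).
      by rewrite lt_def qs; apply: posM => //; exact: pos_b.
    have [c ->] := H s (hS q s hq hqs).
    by eexists; rewrite scalerA.
  exists (\sum_s c s); rewrite [LHS]b_span scaler_suml.
  by apply: eq_bigr => s _; rewrite hc.
- by rewrite (negPf (hp c)).
Qed.

(** An element below [b m *m q *m b n] is a right multiple of [b m] and a left
    multiple of [b n], which leaves one direction. *)
Lemma extreme_product m n q : \det (b m) = 0 -> \det (b n) = 0 ->
  pos q -> b m *m q *m b n != 0 -> extreme (b m *m q *m b n).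
Proof.
move=> dm dn hq z0 y k hy hk.
have [bm0 bn0] : b m != 0 /\ b n != 0.
  by split; apply: contraNneq z0 => ->; rewrite ?mulmx0 ?mul0mx.
have [lm _] := extreme_left_right (@extreme_b m).
have [_ rn] := extreme_left_right (@extreme_b n).
have [|r yr] := dominated_right_multiple bm0 (pos_b m) lm hy.
  move=> p hp; exists (k * \tr (b m *m (q *m b n *m p))).
  rewrite -scalerA -singular_sandwich //.
  have := posM (posM hk hp) (pos_b m).
  by rewrite !mulmxBl -!scalemxAl !mulmxA.
have [|r' yr'] := dominated_left_multiple bn0 (pos_b n) rn hy.
  move=> p hp; exists (k * \tr (b n *m (p *m b m *m q))).
  rewrite -scalerA -singular_sandwich //.
  have := posM (posM (pos_b n) hp) hk.
  by rewrite mulmxBr -scalemxAr !mulmxA.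
have [u [f bm]] := rank1_factor dm bm0; have [u' [f' bn]] := rank1_factor dn bn0.
have u0 : u != 0 by apply: contraNneq bm0 => u0; rewrite bm u0 mul0mx.
have [c yc] : exists c, y = c *: (u *m f').
  have e : u *m (f *m r) = (r' *m u') *m f'.
    by rewrite mulmxA -bm -mulmxA -bn -yr -yr'.
  have [c ec] := common_direction u0 e; exists c.
  by rewrite yr bm -mulmxA.
have [d zd] : exists d, b m *m q *m b n = d *: (u *m f').
  by exists ((f *m q *m u') 0 0); rewrite bm bn mulmx_rank1.
have d0 : d != 0 by apply: contraNneq z0; rewrite zd => ->; rewrite scale0r.
by exists (c / d); rewrite zd scalerA divfK.
Qed.

End SimplicialCone.

Section SimplicialConeStructure.
Variables (K : realType) (I : finType) (b : I -> 'M[K]_2).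
Variables (beta : I -> 'M[K]_2 -> K) (hb : positive_basis b beta).

Lemma right_neighbour m : \det (b m) = 0 ->
  exists n r, b n = b m *m r /\ forall c, b n != c *: b m.
Proof.
rewrite -det_tr => /(left_neighbour (positive_basis_tr hb)) [n [r [e h]]].
exists n, r^T; split; first by apply: trmx_inj; rewrite trmx_mul trmxK.
move=> c; apply: contra (h c) => /eqP ->; by rewrite linearZ.
Qed.

(** Each [b k] is a combination of the four products, each of which lies on the
    ray of some basis element; by independence [b k] is one of these. *)
Lemma simplicial_cone_structure : exists X Y : 'M[K]_2,
  [/\ forall i j, exists k c, 0 < c /\ col i X *m row j Y = c *: b k,
      forall k, exists i j c, 0 < c /\ b k = c *: (col i X *m row j Y) &
      forall i j, 0 <= (Y *m X) i j].
Proof.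
have b0 := b_neq0 hb; have hpos := pos_b hb.
have [m dm] := exists_extreme_singular hb.
have [n [r [bn hn]]] := left_neighbour hb dm.
have [k [r' [bk hk]]] := right_neighbour dm.
have dn : \det (b n) = 0 by rewrite bn det_mulmx dm mulr0.
have dk : \det (b k) = 0 by rewrite bk det_mulmx dm mul0r.
have [u [f bm]] := rank1_factor dm (b0 m).
pose u' := r *m u; pose f' := f *m r'.
have bn' : b n = u' *m f by rewrite bn bm mulmxA.
have bk' : b k = u *m f' by rewrite bk bm -mulmxA.
have [q hq z0] : exists2 q, pos beta q & b n *m q *m b k != 0.
  apply: contrapT => H.
  have {}H q : b n *m q *m b k = 0.
    have [|p hp|c ->] := @multiple_of_pos_multiple _ _ _ _ hb
      (fun q => b n *m q *m b k) 0 _ _ q.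
    - by move=> ? ?; rewrite mulmxBr mulmxBl.
    - exists 0; rewrite scaler0; apply: contrapT => /eqP hz; by apply: H; exists p.
    - by rewrite scaler0.
  have [p [p' e]] := one_in_ideal (b0 k).
  move/eqP: (b0 n); apply; rewrite -[LHS]mulmx1 e mulmx_sumr big1 // => j _.
  by rewrite !mulmxA H mul0mx.
have ez := extreme_product hb dn dk hq z0.
have hz : pos beta (b n *m q *m b k) by do 2!apply: (posM hb) => //.
have [l [c [c0 zl]]] := extreme_basis_multiple hb hz z0 ez.
pose d := (f *m q *m u) 0 0.
have zd : b n *m q *m b k = d *: (u' *m f') by rewrite bn' bk' mulmx_rank1.
have d0 : 0 < d.
  rewrite lt_def; apply/andP; split.
    by apply: contraNneq z0 => e; rewrite zd e scale0r.
  apply: (pos_scalar_ge0 hb (b0 m) (hpos m)).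
  have -> : d *: b m = b m *m q *m b m by rewrite bm mulmx_rank1.
  by do 2!apply: (posM hb) => //.
pose X : 'M[K]_2 := \matrix_(i, j) (if j == 0 then u i 0 else u' i 0).
pose Y : 'M[K]_2 := \matrix_(i, j) (if i == 0 then f 0 j else f' 0 j).
have X0 : col 0 X = u by apply/matrixP => i j; rewrite !mxE ord1.
have X1 : col 1 X = u' by apply/matrixP => i j; rewrite !mxE ord1.
have Y0 : row 0 Y = f by apply/matrixP => i j; rewrite !mxE ord1.
have Y1 : row 1 Y = f' by apply/matrixP => i j; rewrite !mxE ord1.
have rays i j : exists k c, 0 < c /\ col i X *m row j Y = c *: b k.
  case: (ord2P i) (ord2P j) => -> [] ->; rewrite ?X0 ?X1 ?Y0 ?Y1.
  - by exists m, 1; rewrite scale1r.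
  - by exists k, 1; rewrite scale1r.
  - by exists n, 1; rewrite scale1r.
  - exists l, (d^-1 * c); rewrite mulr_gt0 ?invr_gt0 //; split=> //.
    by rewrite -scalerA -zl zd scalerA mulVf ?scale1r // gt_eqF.
have u0 : u != 0 by apply: contraNneq (b0 m) => e; rewrite bm e mul0mx.
have f0 : f != 0 by apply: contraNneq (b0 m) => e; rewrite bm e mulmx0.
have uX : X \in unitmx.
  rewrite unitmxE unitfE; apply/eqP => dX.
  have [|a ea] := det0_col_multiple dX; first by rewrite X0.
  by move: (hn a); rewrite bn' bm -X1 ea X0 -scalemxAl eqxx.
have uY : Y \in unitmx.
  rewrite -unitmx_tr unitmxE unitfE; apply/eqP => dY.
  have [|a] := det0_col_multiple dY; rewrite -!tr_row; first by rewrite Y0 trmx_eq0.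
  rewrite Y0 Y1 -linearZ => /trmx_inj ea.
  by move: (hk a); rewrite bk' bm ea -scalemxAr eqxx.
exists X, Y; split=> //.
- move=> i; pose C := invmx X *m b i *m invmx Y.
  have bi : b i = \sum_a \sum_b C a b *: (col a X *m row b Y).
    by rewrite -mulmx_sum_col_row /C !mulmxA mulmxV // mul1mx mulmxKV.
  apply: contrapT => H.
  have : beta i (b i) = 0.
    rewrite bi (beta_sum hb) big1 // => a _; rewrite (beta_sum hb) big1 // => a' _.
    have [j [e [e0 ze]]] := rays a a'.
    rewrite ze !(betaZ hb) (positive_basis_dual hb); case: eqVneq => [ij|_].
      case: H; exists a, a', e^-1; rewrite invr_gt0; split=> //.
      by rewrite ze ij scalerA mulVf ?scale1r // gt_eqF.
    by rewrite !mulr0.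
  by rewrite (positive_basis_dual hb) eqxx => /eqP; rewrite oner_eq0.
- move=> i j; have [l' [e [e0 ze]]] := rays j i.
  have hz' : pos beta (col j X *m row i Y).
    by rewrite ze; apply: (posZ hb); rewrite ?ltW.
  have z0' : col j X *m row i Y != 0.
    by rewrite ze scaler_eq0 negb_or gt_eqF //=.
  apply: (pos_scalar_ge0 hb z0' hz').
  have -> : (Y *m X) i j *: (col j X *m row i Y) =
    (col j X *m row i Y) *m (col j X *m row i Y).
    rewrite -[X in _ = X *m _]mulmx1 mulmx_rank1 mulmx1; congr (_ *: _).
    by rewrite !mxE; apply: eq_bigr => s _; rewrite !mxE.
  exact: (posM hb).
Qed.

End SimplicialConeStructure.
(** * Primitive vectors over a GCD-domain *)

Section Gauss.
Variables (R : idomainType) (hR : GCD_domain R).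
Implicit Types (a b c d : R) (v w : 'I_2 -> R).

Definition primitive_pair v :=
  forall c, rdvd c (v 0) -> rdvd c (v 1) -> c \is a GRing.unit.

(** A greatest common divisor of [c * v 0] and [c * v 1] is associated to [c]. *)
Lemma coprime_euclid v c : primitive_pair v -> rdvd (v 0) (c * v 1) -> rdvd (v 0) c.
Proof.
move=> hv [e he].
have [v0|v0] := eqVneq (v 0) 0.
  have v1 : v 1 \is a GRing.unit.
    by apply: hv; [exists 0; rewrite v0 mulr0|exists 1; rewrite mulr1].
  move/eqP: he; rewrite v0 mul0r mulf_eq0 => /orP[/eqP ->|/eqP v10].
    by exists 0; rewrite mul0r.
  by rewrite v10 unitr0 in v1.
have [v1|v1] := eqVneq (v 1) 0.
  have u : v 0 \is a GRing.unit.
    by apply: hv; [exists 1; rewrite mulr1|exists 0; rewrite v1 mulr0].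
  by exists ((v 0)^-1 * c); rewrite mulVKr.
have [->|c0] := eqVneq c 0; first by exists 0; rewrite mulr0.
have [g [ga gb gP]] := hR (mulf_neq0 c0 v0) (mulf_neq0 c0 v1).
have [h gE] : rdvd c g by apply: gP; [exists (v 0)|exists (v 1)].
have hu : h \is a GRing.unit.
  apply: hv.
    by move: ga => [k]; rewrite gE -mulrA => /(mulfI c0) ->; exists k.
  by move: gb => [k]; rewrite gE -mulrA => /(mulfI c0) ->; exists k.
have [k gk] : rdvd (v 0) g.
  by apply: gP; [exists c; rewrite mulrC|exists e].
by exists (k / h); rewrite mulrA -gk gE mulrK.
Qed.

Lemma primitive_multiple v w : primitive_pair v -> w 0 * v 1 = w 1 * v 0 ->
  exists c, forall i, w i = c * v i.
Proof.
move=> hv e.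
have [c wc] : rdvd (v 0) (w 0).
  by apply: coprime_euclid => //; exists (w 1); rewrite e mulrC.
have [v0|v0] := eqVneq (v 0) 0.
  have v1 : v 1 \is a GRing.unit.
    by apply: hv; [exists 0; rewrite v0 mulr0|exists 1; rewrite mulr1].
  exists (w 1 / v 1) => i; case: (ord2P i) => ->; last by rewrite divrK.
  by rewrite wc v0 mul0r mulr0.
exists c => i; case: (ord2P i) => ->; first by rewrite wc mulrC.
by apply: (mulIf v0); rewrite -e wc; ring.
Qed.

Lemma primitive_part v i : v i != 0 -> exists d w,
  [/\ d != 0, primitive_pair w & forall j, v j = d * w j].
Proof.
move=> vi; have unit_pair (w : 'I_2 -> R) j : w j = 1 -> primitive_pair w.
  move=> wj c h0 h1; have [k e] : rdvd c 1 by rewrite -wj; case: (ord2P j) => ->.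
  by apply/unitrP; exists k; rewrite mulrC -e.
have [v0|v0] := eqVneq (v 0) 0.
  have v1 : v 1 != 0 by case: (ord2P i) vi => -> //; rewrite v0 eqxx.
  exists (v 1), (fun j => if j == 0 then 0 else 1); split=> //.
    exact: (@unit_pair _ 1).
  by move=> j; case: (ord2P j) => -> /=; rewrite ?mulr1 // mulr0.
have [v1|v1] := eqVneq (v 1) 0.
  exists (v 0), (fun j => if j == 0 then 1 else 0); split=> //.
    exact: (@unit_pair _ 0).
  by move=> j; case: (ord2P j) => -> /=; rewrite ?mulr1 // mulr0.
have [d [[a va] [b vb] dP]] := hR v0 v1.
have d0 : d != 0 by apply: contraNneq v0 => e; rewrite va e mul0r.
exists d, (fun j => if j == 0 then a else b); split=> //.
  move=> c /= [k ak] [l bl]; have [m dm] : rdvd (d * c) d.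
    by apply: dP; [exists k; rewrite va ak mulrA|exists l; rewrite vb bl mulrA].
  apply/unitrP; exists m; rewrite mulrC; split=> //;
  by apply: (mulfI d0); rewrite mulrA -dm mulr1.
by move=> j; case: (ord2P j) => -> /=.
Qed.

Lemma primitive_neq0 v : primitive_pair v -> exists i, v i != 0.
Proof.
move=> hv; have [v0|] := eqVneq (v 0) 0; last by exists 0.
have [v1|] := eqVneq (v 1) 0; last by exists 1.
have : (0 : R) \is a GRing.unit by apply: hv; exists 0; rewrite mulr0.
by rewrite unitr0.
Qed.

Lemma primitive_pairN v : primitive_pair v -> primitive_pair (fun i => - v i).
Proof.
move=> hv c [k e0] [l e1]; apply: hv; [exists (- k)|exists (- l)];
by rewrite mulrN -?e0 -?e1 opprK.
Qed.

End Gauss.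

Section RealPrimitive.
Variables (K : realType) (S : {pred K}) (R : subIdomainType S).
Hypothesis hR : GCD_domain R.

Lemma primitive_direction (v : 'I_2 -> R) (w : 'I_2 -> K) t i :
  v i != 0 -> (forall j, val (v j) = t * w j) ->
  exists (v' : 'I_2 -> R) (s : K),
    [/\ primitive_pair v', 0 < s & forall j, val (v' j) = s * w j].
Proof.
move=> vi hv; have [d [v' [d0 hv' e]]] := primitive_part hR vi.
have dK : val d != 0 by rewrite val_eq0R.
have e' j : val (v' j) = (t / val d) * w j.
  have : val d * val (v' j) = t * w j by rewrite -hv e rmorphM.
  by move=> h; apply: (mulfI dK); rewrite h; field.
have t0 : t / val d != 0.
  rewrite mulf_neq0 ?invr_eq0 //; apply: contraNneq vi => t0.
  by rewrite -val_eq0R hv t0 mul0r.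
have [tp|tn|t00] := ltrgtP (t / val d) 0.
- exists (fun j => - v' j), (- (t / val d)); split.
  + exact: primitive_pairN.
  + by rewrite oppr_gt0.
  + by move=> j; rewrite rmorphN /= e' mulNr.
- by exists v', (t / val d).
- by rewrite t00 eqxx in t0.
Qed.

(** Gauss's lemma for matrices of rank one: a real multiple of a product of
    primitive vectors has entries in [R] only if the factor is in [R]. *)
Lemma primitive_product_multiple (x : 'M[R]_2) (v w : 'I_2 -> R) (c : K) :
  primitive_pair v -> primitive_pair w ->
  (forall i j, val (x i j) = c * (val (v i) * val (w j))) ->
  exists2 r : R, val r = c & forall i j, x i j = r * (v i * w j).
Proof.
move=> hv hw hx.
have [j0 wj0] := primitive_neq0 hw; have [i0 vi0] := primitive_neq0 hv.
have wK : val (w j0) != 0 by rewrite val_eq0R.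
have vK : val (v i0) != 0 by rewrite val_eq0R.
have /choice[e he] : forall i, exists e, forall j, x i j = e * w j.
  move=> i; have h : x i 0 * w 1 = x i 1 * w 0.
    by apply: val_inj; rewrite !rmorphM /= !hx; ring.
  exact: (primitive_multiple hR hw h).
have eK i : val (e i) = c * val (v i).
  by apply: (mulIf wK); rewrite -val_mulR -he hx mulrA.
have h : e 0 * v 1 = e 1 * v 0.
  by apply: val_inj; rewrite !rmorphM /= !eK; ring.
have [r hr] := primitive_multiple hR hv h.
exists r; first by apply: (mulIf vK); rewrite -val_mulR -hr eK.
by move=> i j; rewrite he hr mulrA.
Qed.

End RealPrimitive.

(** * Factorization of the cone *)

Section ConeStructure.
Variables (K : realType) (S : {pred K}) (R : subIdomainType S).
Variables (P : set 'M[R]_2) (hP : is_lalgebra P).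
Implicit Types (x y : 'M[R]_2).

Lemma proportional_val x y : y != 0 -> proportional x y ->
  exists c : K, forall i j, val (x i j) = c * val (y i j).
Proof.
move=> /matrix_neq0_entry [k [l ykl]] h.
have yK : val (y k l) != 0 by rewrite val_eq0R.
exists (val (x k l) / val (y k l)) => i j; apply: (mulIf yK).
by rewrite -val_mulR h val_mulR; field.
Qed.

Lemma cone_val_multiple x y (c : K) : P y -> 0 <= c ->
  (forall i j, val (x i j) = c * val (y i j)) -> P x.
Proof.
move=> Py c0 h; have [y0|] := eqVneq y 0.
  suff -> : x = 0 by exact: cone0.
  by apply/matrixP => i j; apply: val_inj; rewrite h y0 mxE rmorph0 mulr0.
move=> /matrix_neq0_entry [k [l ykl]]; apply: (proportional_cone hP Py _ ykl).
  by move=> i j k' l'; apply: val_inj; rewrite !rmorphM /= !h; ring.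
by rewrite rmorphM /= h -mulrA mulr_ge0 // -expr2 sqr_ge0.
Qed.

Lemma cone_val_nonneg x y (c : K) : P x -> P y -> y != 0 ->
  (forall i j, val (x i j) = c * val (y i j)) -> 0 <= c.
Proof.
move=> Px Py y0 h; rewrite leNgt; apply/negP => c0.
have PNx : P (- x).
  apply: (@cone_val_multiple _ y (- c)) => //; first by rewrite oppr_ge0 ltW.
  by move=> i j; rewrite mxE rmorphN /= h mulNr.
have [k [l ykl]] := matrix_neq0_entry y0.
have := h k l; rewrite (cone_eq0 hP Px PNx) mxE rmorph0 => /esym/eqP.
by rewrite mulf_eq0 val_eq0R (negPf ykl) orbF lt_eqF.
Qed.

Definition valmx x : 'M[K]_2 := map_mx val x.

(** At most four lines carry the cone and the cone spans a space of dimension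
    four, so their generators form a basis over the reals. *)
Lemma exists_positive_basis : exists (I : finType) (b : I -> 'M[R]_2),
  [/\ forall i, P (b i), forall i, b i != 0,
   exists beta, positive_basis (fun i => valmx (b i)) beta &
   forall x, P x -> exists (X : I -> 'M[R]_2) (c : I -> K),
    [/\ forall i, 0 <= c i, forall i, valmx (X i) = c i *: valmx (b i) &
        x = \sum_i X i]].
Proof.
have [I [b [Pb b0 I4 hdec]]] := cone_decomposition hP.
have {}hdec x : P x -> exists (X : I -> 'M[R]_2) (c : I -> K),
    [/\ forall i, 0 <= c i, forall i, valmx (X i) = c i *: valmx (b i) &
        x = \sum_i X i].
  move=> /hdec[X [hX xE]].
  have /choice[c hc] i : exists c, forall k l, val (X i k l) = c * val (b i k l).
    by have [_ ] := hX i; exact: proportional_val.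
  exists X, c; split=> // i; last by apply/matrixP => k l; rewrite !mxE hc.
  by have [PX _] := hX i; exact: cone_val_nonneg (hc i).
have span_P x : P x -> exists2 c : I -> K, forall i, 0 <= c i &
    valmx x = \sum_i c i *: valmx (b i).
  move=> /hdec[X [c [c0 hX ->]]]; exists c => //.
  by rewrite /valmx raddf_sum; apply: eq_bigr => i _; exact: hX.
exists I, b; split=> //.
pose B : 'M[K]_(#|I|, 2 * 2) := \matrix_i mxvec (valmx (b (enum_val i))).
have rowB i : row (enum_rank i) B = mxvec (valmx (b i)) by rewrite rowK enum_rankK.
have comb_sub (c : I -> K) : (mxvec (\sum_i c i *: valmx (b i)) <= B)%MS.
  rewrite linear_sum; apply: summx_sub => i _; rewrite linearZ /= scalemx_sub //.
  by rewrite -rowB row_sub.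
have Bfull : row_full B.
  rewrite -sub1mx; apply/row_subP => q.
  rewrite -[row q _]vec_mxK [vec_mx _]matrix_sum_delta.
  rewrite linear_sum; apply: summx_sub => k _.
  rewrite linear_sum; apply: summx_sub => l _; rewrite linearZ /= scalemx_sub //.
  have [u [v [Pu Pv e _]]] := pos_neg_parts hP (delta_mx k l).
  have -> : delta_mx k l = valmx u - valmx v.
    by rewrite /valmx -raddfB -e; apply/matrixP => i j; rewrite !mxE /= val_natr.
  have [c _ ->] := span_P u Pu; have [d _ ->] := span_P v Pv.
  by rewrite linearB; apply: addmx_sub; rewrite ?eqmx_opp; exact: comb_sub.
have Bfree : row_free B.
  rewrite /row_free eqn_leq rank_leq_row /=; move: Bfull => /eqP ->.
  exact: I4.
pose beta i (x : 'M[K]_2) : K := (mxvec x *m pinvmx B) 0 (enum_rank i).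
have beta_lin i : scalar (beta i).
  by move=> a x y; rewrite /beta linearP mulmxDl -scalemxAl !mxE.
have beta_b i j : beta i (valmx (b j)) = (i == j)%:R.
  rewrite /beta -rowB -row_mul mulmxVp //.
  by rewrite !mxE (inj_eq enum_rank_inj) eq_sym.
have b_span (x : 'M[K]_2) : x = \sum_i beta i x *: valmx (b i).
  apply: (can_inj mxvecK); rewrite -[LHS](mulmxKpV (submx_full _ Bfull)).
  rewrite mulmx_sum_row linear_sum (reindex (@enum_rank I)) /=; last first.
    exact: (onW_bij _ (enum_rank_bij _)).
  by apply: eq_bigr => i _; rewrite linearZ /= rowB.
exists beta; split=> // i j k.
have -> : valmx (b i) *m valmx (b j) = valmx (b i *m b j) by rewrite /valmx map_mxM.
have [c c0 ->] := span_P _ (lalg_mul hP (Pb i) (Pb j)).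
have -> : beta k (\sum_i c i *: valmx (b i)) = c k => //.
rewrite /beta linear_sum mulmx_suml summxE (bigD1 k) //= big1 ?addr0.
  by rewrite linearZ /= -scalemxAl mxE -/(beta k _) beta_b eqxx mulr1.
move=> l lk; rewrite linearZ /= -scalemxAl mxE -/(beta k _) beta_b.
by rewrite eq_sym (negPf lk) mulr0.
Qed.

(** Over the reals each ray is spanned by a column times a row.  Scaling those
    to primitive vectors over [R] makes every element of [P] on the ray an
    [R]-multiple of their product. *)
Lemma cone_factorization (hR : GCD_domain R) : exists U V : 'M[R]_2,
  P = [set U *m C *m V | C in nonnegM2] /\ nonnegM2 (V *m U).
Proof.
have [I [b [Pb b0 [beta hb] hdec]]] := exists_positive_basis.
have [X [Y [rays hrays hYX]]] := simplicial_cone_structure hb.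
have entries i j k c : col i X *m row j Y = c *: valmx (b k) ->
    forall r q, X r i * Y j q = c * val (b k r q).
  by move=> /matrixP e r q; have := e r q; rewrite !mxE big_ord1 !mxE.
have entry k : exists r q, val (b k r q) != 0.
  have [r [q h]] := matrix_neq0_entry (b0 k).
  by exists r, q; rewrite val_eq0R.
have /choice[v hv] (i : 'I_2) : exists v : 'I_2 -> R, exists s : K,
    [/\ primitive_pair v, 0 < s & forall r, val (v r) = s * X r i].
  have [k [c [c0 /entries h]]] := rays i 0; have [r0 [q bk]] := entry k.
  have [||v [s hs]] := @primitive_direction _ _ _ hR (fun r => b k r q)
    (fun r => X r i) (Y 0 q / c) r0; last by exists v, s.
    by rewrite -val_eq0R.
  move=> r; apply: (mulfI (lt0r_neq0 c0)); rewrite -h; field.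
  by rewrite gt_eqF.
have /choice[w hw] (j : 'I_2) : exists w : 'I_2 -> R, exists s : K,
    [/\ primitive_pair w, 0 < s & forall q, val (w q) = s * Y j q].
  have [k [c [c0 /entries h]]] := rays 0 j; have [r [q0 bk]] := entry k.
  have [||w [s hs]] := @primitive_direction _ _ _ hR (fun q => b k r q)
    (fun q => Y j q) (X r 0 / c) q0; last by exists w, s.
    by rewrite -val_eq0R.
  move=> q; apply: (mulfI (lt0r_neq0 c0)); rewrite -h; field.
  by rewrite gt_eqF.
have /choice[s hs] := hv; have /choice[t ht] := hw.
pose U : 'M[R]_2 := \matrix_(r, i) v i r.
pose V : 'M[R]_2 := \matrix_(j, q) w j q.
have UV i j r q : (col i U *m row j V) r q = v i r * w j q.
  by rewrite !mxE big_ord1 !mxE.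
have PUV i j : P (col i U *m row j V).
  have [k [c [c0 /entries h]]] := rays i j.
  have [_ si hsi] := hs i; have [_ tj htj] := ht j.
  apply: (@cone_val_multiple _ (b k) (s i * t j * c)) => //.
    by rewrite !mulr_ge0 // ltW.
  by move=> r q; rewrite UV val_mulR hsi htj -mulrA -h; ring.
exists U, V; split; last first.
  apply/mxOverP => i j; rewrite nonnegE mulmx2E !mxE rmorphD /= !val_mulR.
  have [_ si hsi] := hs j; have [_ tj htj] := ht i.
  rewrite !hsi !htj.
  have -> : t i * Y i 0 * (s j * X 0 j) + t i * Y i 1 * (s j * X 1 j) =
    t i * s j * (Y *m X) i j by rewrite mulmx2E; ring.
  by rewrite !mulr_ge0 // ltW.
apply/seteqP; split=> [x Px|x [C hC <-]]; last first.
  rewrite mulmx_sum_col_row; do 2!apply: (cone_sum hP) => ? _.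
  apply: (lalg_scale hP) => //; exact/mxOverP.
have [x_ [c [c0 hx ->]]] := hdec x Px.
have /choice[C hC] k : exists C, nonnegM2 C /\ x_ k = U *m C *m V.
  have [i [j [d [d0 e]]]] := hrays k.
  have [pv si hsi] := hs i; have [pw tj htj] := ht j.
  have hxk r q : val (x_ k r q) = c k * d / (s i * t j) * (val (v i r) * val (w j q)).
    move/matrixP/(_ r q): (hx k); rewrite !mxE => ->.
    move/matrixP/(_ r q): e; rewrite !mxE big_ord1 !mxE => ->.
    by rewrite hsi htj; field; rewrite !gt_eqF.
  have [a av ha] := primitive_product_multiple hR pv pw hxk.
  exists (a *: delta_mx i j); split.
    apply/mxOverP => r q; rewrite nonnegE !mxE val_mulR val_natr av.
    by rewrite !mulr_ge0 ?invr_ge0 ?mulr_ge0 // ltW.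
  apply/matrixP => r q; rewrite -scalemxAr -scalemxAl mxE ha; congr (_ * _).
  by rewrite -UV colE rowE mulmxA -[U *m _ *m delta_mx _ _]mulmxA mul_delta_mx.
exists (\sum_k C k).
  apply/mxOverP => r q; rewrite summxE nonnegE rmorph_sum; apply: sumr_ge0 => k _.
  by have [/mxOverP h _] := hC k; exact: h.
by rewrite mulmx_sumr mulmx_suml; apply: eq_bigr => k _; have [_ ->] := hC k.
Qed.

End ConeStructure.

(** * Transport along algebra isomorphisms *)

Section Transport.
Variables (K : realType) (S : {pred K}) (R : subIdomainType S).

Lemma lalgebra_image (P : set 'M[R]_2) (psi : {lrmorphism 'M[R]_2 -> 'M[R]_2}) :
  bijective psi -> is_lalgebra P -> is_lalgebra (psi @` P).
Proof.
move=> [phi psiK phiK] hP.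
have imE y : (psi @` P) y = P (phi y).
  apply/propext; split=> [[x Px <-]|Py]; first by rewrite psiK.
  by exists (phi y).
have phiB x y : phi (x - y) = phi x - phi y.
  by rewrite -{1}(phiK x) -{1}(phiK y) -raddfB psiK.
have leE x y : cone_le (psi @` P) x y = cone_le P (phi x) (phi y).
  by rewrite /cone_le imE phiB.
split.
- move=> _ _ [x Px <-] [y Py <-]; exists (x + y); last by rewrite raddfD.
  exact: lalg_add.
- move=> _ _ [x Px <-] [y Py <-]; exists (x *m y); last exact: rmorphM.
  exact: lalg_mul.
- move=> r _ r0 [x Px <-]; exists (r *: x); last by rewrite linearZ.
  exact: lalg_scale.
- apply/seteqP; split=> [_ [[x Px <-] [_ [y Py <-]]]|_ ->].
    rewrite -raddfN => /(can_inj psiK) e; rewrite /= (cone_eq0 hP Px) ?raddf0 //.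
    by rewrite -e opprK.
  have i0 : (psi @` P) 0 by exists 0; [exact: cone0|rewrite raddf0].
  by split=> //; exists 0; rewrite ?oppr0.
- move=> x y; have [z [xz yz zP]] := lalg_join hP (phi x) (phi y).
  exists (psi z); split; rewrite ?leE ?psiK // => w; rewrite !leE psiK; exact: zP.
- move=> x y; have [z [xz yz zP]] := lalg_meet hP (phi x) (phi y).
  exists (psi z); split; rewrite ?leE ?psiK // => w; rewrite !leE psiK; exact: zP.
Qed.

Lemma conjugation_lrmorphism (V : 'M[R]_2) : V \in unitmx ->
  exists2 psi : {lrmorphism 'M[R]_2 -> 'M[R]_2}, bijective psi &
    forall x, psi x = V *m x *m invmx V.
Proof.
move=> uV; pose f (x : 'M[R]_2) := V *m x *m invmx V.
have f_lin : linear f.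
  by move=> a x y; rewrite /f mulmxDr mulmxDl -scalemxAr -scalemxAl.
have f_mul : monoid_morphism f.
  split; first by rewrite /f mulmx1 mulmxV.
  move=> x y; change (f (x *m y) = f x *m f y).
  by rewrite /f !mulmxA mulmxKV.
pose fL := GRing.isLinear.Build R 'M[R]_2 'M[R]_2 *:%R f f_lin.
pose fM := GRing.isMonoidMorphism.Build 'M[R]_2 'M[R]_2 f f_mul.
pose psi : {lrmorphism 'M[R]_2 -> 'M[R]_2} := HB.pack f fL fM.
exists psi => //; exists (fun x => invmx V *m x *m V) => x /=.
  by rewrite /f !mulmxA mulVmx // mul1mx mulmxKV.
by rewrite /f !mulmxA mulmxV // mul1mx mulmxK.
Qed.

End Transport.

Theorem theorem2p5 (K : realType) (S : {pred K}) (R : subIdomainType S)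
    (hR : GCD_domain R) (P : set 'M[R]_2) (hP : is_lalgebra P) :
  exists A : 'M[R]_2,
    [/\ nonnegM2 A, \det A \is a GRing.unit,
        is_lalgebra (cone_of A) & lalgebra_iso P (cone_of A)].
Proof.
have [U [V [PE hVU]]] := cone_factorization hP hR.
(* The cone generates the algebra, so [1] itself factors through [U] and [V]. *)
have [C uCv] : exists C, 1%:M = U *m C *m V.
  have [u [v [+ + -> _]]] := pos_neg_parts hP 1%:M.
  rewrite {1 2}PE => -[C _ <-] [D _ <-].
  by exists (C - D); rewrite mulmxBr mulmxBl.
have : \det U * \det C * \det V \is a GRing.unit.
  by rewrite -!det_mulmx -uCv det1 unitr1.
rewrite !unitrM => /andP[/andP[uU _] uV].
have [psi psi_bij psiE] := conjugation_lrmorphism (uV : V \in unitmx).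
have im : psi @` P = cone_of (V *m U).
  rewrite PE; apply/seteqP; split=> [_ [_ [D hD <-] <-]|_ [D hD <-]].
    by exists D => //; rewrite psiE !mulmxA mulmxK.
  by exists (U *m D *m V); [exists D|rewrite psiE !mulmxA mulmxK].
exists (V *m U); split=> //.
- by rewrite det_mulmx unitrM uV uU.
- by rewrite -im; exact: lalgebra_image.
- by exists psi.
Qed.
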